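(* Let $\mu$ be an s-graphon, i.e. a symmetric Borel probability measure on $[0,1]^2$. Then there is a sequence $\{G_i\}_{i=1}^\infty$ of finite graphs (with non-empty edge sets) that is s-convergent and whose limit is $\mu$; that is, for every natural number $k$ the sets $C_0(G_i,k)$ converge in the Hausdorff metric to $C(\mu,k)$.
   Context: Natural numbers $k$ are positive. A measure on $[0,1]^2$ is symmetric if it is invariant under $(x,y)\mapsto(y,x)$. $\mathcal{K}(k,n)$ is the set of all non-negative real $k\times n$ matrices with every row sum equal to $n/k$ and every column sum equal to $1$. For an $n\times n$ matrix $S$, $C(S,k)=\{MSM^T : M\in\mathcal{K}(k,n)\}\subset\mathbb{R}^{k\times k}$. For a finite graph $G$ with non-empty edge set and adjacency matrix $A_G$, $C_0(G,k)=\|A_G\|_1^{-1}\,C(A_G,k)$, where $\|A_G\|_1$ is the sum of the absolute values of the entries of $A_G$. A sequence $\{G_i\}$ of such graphs is s-convergent if for every natural number $k$ the sets $C_0(G_i,k)$ converge in the Hausdorff metric (on compact subsets of $\mathbb{R}^{k\times k}$, induced by the entrywise $\ell_1$ norm). For a finite Borel measure $\mu$ on $[0,1]^2$, $C(\mu,k)$ is the topological closure in $\mathbb{R}^{k\times k}$ of the set of all $k\times k$ matrices $M$ with $M(i,j)=\int_{[0,1]^2} f_i(x)f_j(y)\,d\mu(x,y)$, where $f_1,\dots,f_k$ range over all families of non-negative Borel measurable functions on $[0,1]$ with $\sum_{i=1}^k f_i=1$ everywhere and $\int_0^1 f_i\,d\lambda=1/k$ for each $i$ ($\lambda$ is Lebesgue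 measure). *)

(* Defs.v *)
From HB Require Import structures.
From mathcomp Require Import all_boot all_order all_algebra.
From mathcomp Require Import all_classical all_reals all_analysis.

Set Implicit Arguments.
Unset Strict Implicit.
Unset Printing Implicit Defensive.
Import Order.TTheory GRing.Theory Num.Theory.
Import numFieldNormedType.Exports.
Local Open Scope classical_set_scope.
Local Open Scope ring_scope.

Definition mxl1 (R : realType) (m n : nat) (A : 'M[R]_(m, n)) : R :=
  \sum_(i < m) \sum_(j < n) `|A i j|.

(* The supremum and infimum are extended-real, so that no default value is
   ever taken: a set at infinite distance from another one yields +oo. *)
Definition hausdorff_dist (R : realType) (k : nat) (A B : set 'M[R]_k)
    : \bar R :=
  Order.max
    (ereal_sup [set ereal_inf [set (mxl1 (a - b))%:E | b in B] | a in A])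
    (ereal_sup [set ereal_inf [set (mxl1 (a - b))%:E | a in A] | b in B]).

(* Convergence in the metric space of non-empty compact subsets.  The topology
   of 'M[R]_k used by [compact] and [closure] is the entrywise one, which is
   the topology of the norm mxl1. *)
Definition hausdorff_cvg (R : realType) (k : nat) (F : nat -> set 'M[R]_k)
    (L : set 'M[R]_k) : Prop :=
  [/\ forall i, F i !=set0 /\ compact (F i),
      L !=set0 /\ compact L
    & (fun i => hausdorff_dist (F i) L) @ \oo --> (0 : \bar R)%E].

Definition Kmx (R : realType) (k n : nat) : set 'M[R]_(k, n) :=
  [set M | [/\ forall i j, 0 <= M i j,
               forall i, \sum_(j < n) M i j = n%:R / k%:R
             & forall j, \sum_(i < k) M i j = 1]].

Definition Cmx (R : realType) (n : nat) (S : 'M[R]_n) (k : nat)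
    : set 'M[R]_k :=
  [set M *m S *m M^T | M in @Kmx R k n].
Arguments Cmx {R n} S k _.

Record sgraph := SGraph {
  gorder : nat;
  gedge : rel 'I_gorder;
  gedge_sym : symmetric gedge;
  gedge_irr : irreflexive gedge }.

Definition has_edge (G : sgraph) : Prop := exists x y : 'I_(gorder G), gedge x y.

Definition adjmx (R : realType) (G : sgraph) : 'M[R]_(gorder G) :=
  \matrix_(x, y) (gedge x y)%:R.

Definition C0 (R : realType) (G : sgraph) (k : nat) : set 'M[R]_k :=
  [set (mxl1 (adjmx R G))^-1 *: N | N in Cmx (adjmx R G) k].
Arguments C0 R G k _ : clear implicits.

Definition s_convergent (R : realType) (G : nat -> sgraph) : Prop :=
  forall k : nat, (0 < k)%N ->
    exists L : set 'M[R]_k, hausdorff_cvg (fun i => C0 R (G i) k) L.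

Definition unitI (R : realType) : set (measurableTypeR R) := `[0, 1].
Arguments unitI R _ : clear implicits.

Definition unitsq (R : realType)
    : set (measurableTypeR R * measurableTypeR R)%type :=
  unitI R `*` unitI R.
Arguments unitsq R _ : clear implicits.

(* Borel measures on the unit square are represented as measures on the plane
   that vanish outside the square. *)
Definition sgraphon (R : realType)
    (mu : probability (measurableTypeR R * measurableTypeR R)%type R) : Prop :=
  mu (~` unitsq R) = 0%E /\
  forall A, measurable A -> mu (swap_pair @^-1` A) = mu A.

Definition frac_partition (R : realType) (k : nat)
    (f : 'I_k -> measurableTypeR R -> R) : Prop :=
  [/\ forall i, measurable_fun (unitI R) (f i),
      forall i x, unitI R x -> 0 <= f i x,
      forall x, unitI R x -> \sum_(i < k) f i x = 1
    & forall i,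
        (\int[lebesgue_measure]_(x in unitI R) (f i x)%:E = (k%:R^-1)%:E)%E].

Definition Cmeas (R : realType)
    (mu : {finite_measure set (measurableTypeR R * measurableTypeR R)%type
             -> \bar R})
    (k : nat) : set 'M[R]_k :=
  closure [set M : 'M[R]_k | exists2 f, @frac_partition R k f &
    forall i j,
      ((M i j)%:E = \int[mu]_(z in unitsq R) (f i z.1 * f j z.2)%:E)%E].
Arguments Cmeas {R} mu k _.

(* Main.v *)
Require Import Defs.
From mathcomp Require Import all_boot all_order all_algebra.
From mathcomp Require Import all_classical all_reals all_analysis.
From mathcomp Require Import measurable_realfun ring lra.

(** Cut the unit interval into n equal cells and let S be the n x n matrix of
    the masses that mu gives to the products of two cells.  Functions that are
    constant on the cells correspond to the matrices of [Kmx k n], and their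
    energies against mu are the entries of M S M^T; hence C(S,k) is contained
    in C(mu,k) ([Cmx_cell_mass_sub]).  Conversely C(S,k) comes close to all of
    C(mu,k) as n grows.  A fractional partition f has to be approximated by
    step functions at once in L1 of Lebesgue measure, which controls the
    constraint that every part has integral 1/k, and in L1 of the marginals of
    mu, which controls the energies.  These measures may be mutually singular,
    so the approximation takes place in L1 of their sum ([control_measure]).
    Step functions are dense there ([step_approx_unit]), and a nearby family
    of step functions is rounded to an exact fractional partition
    ([partition_step_approx]).  Compactness of C(mu,k) makes the level n
    uniform over all its points ([Cmeas_step_approx]).

    It remains to find a graph G with C_0(G,k) close to C(S,k) for all k
    simultaneously ([graph_of_matrix]).  Blow up every index a of S to a copy
    of the plane F^2 over a finite field F with q elements, and join (a, x) to
    (b, y) when x.2 + y.2 - x.1 * y.1 lies in a subset T_ab of F with about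
    q S_ab elements.  Between two blocks this graph has edge density close to
    S_ab, and it is pseudo-random: two distinct lines of an affine plane meet
    in at most one point, so a second moment computation shows that all
    weighted edge counts agree with those of a constant density up to a
    relative error of order 1/sqrt q ([incidence_mixing]).  An element of
    [Kmx k (n q^2)] thus has nearly the same energy as the matrix of its block
    averages, and every element of [Kmx k n] arises as such averages.

    Taking at stage n the n-cell matrix of mu and a graph with error 1/n gives
    the sequence. *)

Set Implicit Arguments.
Unset Strict Implicit.
Unset Printing Implicit Defensive.
Import Order.TTheory GRing.Theory Num.Theory.
Import numFieldNormedType.Exports.
Local Open Scope classical_set_scope.
Local Open Scope ring_scope.

(** * Pseudo-random bipartite graphs from an affine plane *)

(** For fixed y and t this is the line x.2 = y.1 * x.1 + (t - y.2) of the affine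
    plane over F, and every non-vertical line has this form; the formula is
    symmetric in the point x and the line y, so that it can serve as the
    adjacency relation of an undirected graph. *)
Definition incident (F : finFieldType) (t : F) (x y : F * F) : bool :=
  x.2 + y.2 - x.1 * y.1 == t.

Lemma sum_incident (R : realFieldType) (F : finFieldType) (t : F) (y : F * F) :
  \sum_x (incident t x y)%:R = #|F|%:R :> R.
Proof.
rewrite -(pair_bigA _ (fun a b => (incident t (a, b) y)%:R)) /=.
rewrite -sum1_card natr_sum; apply: eq_bigr => a _.
rewrite (bigD1 (t + a * y.1 - y.2)) //= big1 ?addr0.
  by rewrite /incident /= subrK addrK eqxx.
move=> b /negP nb; rewrite /incident /=; case: eqP => // E; case: nb.
by rewrite -E; apply/eqP; ring.
Qed.

(** Two distinct lines of an affine plane share at most one point. *)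
Lemma common_incident (R : realFieldType) (F : finFieldType) (t : F)
    (y z : F * F) :
  \sum_x (incident t x y)%:R * (incident t x z)%:R
    <= 1 + #|F|%:R * (y == z)%:R :> R.
Proof.
have [->|nyz] := eqVneq y z.
  rewrite mulr1 (@le_trans _ _ #|F|%:R) ?ler_wpDl //.
  rewrite -(sum_incident R t z); apply: ler_sum => x _.
  by case: incident; rewrite ?mulr1 ?mulr0.
rewrite mulr0 addr0.
have -> : \sum_x (incident t x y)%:R * (incident t x z)%:R
    = #|[set x | incident t x y && incident t x z]%SET|%:R :> R.
  rewrite -sum1_card natr_sum [RHS]big_mkcond; apply: eq_bigr => x _.
  by rewrite inE; do 2!case: incident; rewrite /= ?mulr1 ?mulr0.
rewrite lern1; apply/card_le1_eqP => -[a b] [a' b'].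
rewrite !inE /incident /= => /andP[/eqP e1 /eqP e2] /andP[/eqP e3 /eqP e4].
have /eqP : (a - a') * (y.1 - z.1) = 0.
  have -> : (a - a') * (y.1 - z.1) = (b + z.2 - a * z.1) - (b + y.2 - a * y.1)
     - ((b' + z.2 - a' * z.1) - (b' + y.2 - a' * y.1)) by ring.
  by rewrite e1 e2 e3 e4 !subrr.
rewrite mulf_eq0 !subr_eq0 => /orP[/eqP ea|/eqP e].
  congr (_, _) => //; apply/eqP; rewrite -subr_eq0.
  have -> : b' - b = (b' + y.2 - a' * y.1) - (b + y.2 - a * y.1)
    by rewrite ea; ring.
  by rewrite e1 e3 subrr.
case/eqP: nyz; rewrite [y]surjective_pairing [z]surjective_pairing e.
congr (_, _); apply/eqP; rewrite -subr_eq0.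
have -> : y.2 - z.2 = (b + y.2 - a * y.1) - (b + z.2 - a * z.1)
  by rewrite e; ring.
by rewrite e1 e2 subrr.
Qed.

(** The weighted number of lines through x has average (sum of g) / q.  Its
    second moment is a sum over pairs of lines of their number of common
    points, hence at most (sum of g)^2 + q (sum of g^2), which leaves a variance
    too small for a systematic deviation. *)
Lemma incident_deviation (R : realFieldType) (F : finFieldType) (t : F) (w : R)
    (g : F * F -> R) :
  0 < w -> w ^+ 2 <= #|F|%:R -> (forall x, 0 <= g x <= 1) ->
  \sum_x `|\sum_y (incident t x y)%:R * g y - (\sum_y g y) / #|F|%:R|
    <= #|F|%:R ^+ 3 / w.
Proof.
move=> w0 wq g01; set q : R := #|F|%:R; set s := \sum_y g y.
pose h x := \sum_y (incident t x y)%:R * g y; rewrite -/(h _).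
have q0 : 0 < q by apply: lt_le_trans wq; rewrite exprn_gt0.
have sumh : \sum_x h x = q * s.
  rewrite exchange_big /= mulr_sumr; apply: eq_bigr => y _.
  by rewrite -mulr_suml sum_incident.
have sumh2 : \sum_x h x ^+ 2 <= s ^+ 2 + q * \sum_y g y ^+ 2.
  have -> : \sum_x h x ^+ 2 = \sum_y \sum_z g y * g z *
      \sum_x (incident t x y)%:R * (incident t x z)%:R.
    under [RHS]eq_bigr do under eq_bigr do rewrite mulr_sumr.
    under [RHS]eq_bigr do rewrite exchange_big.
    rewrite [RHS]exchange_big; apply: eq_bigr => x _ /=.
    rewrite expr2 mulr_suml; apply: eq_bigr => y _.
    by rewrite mulr_sumr; apply: eq_bigr => z _; ring.
  have -> : s ^+ 2 + q * \sum_y g y ^+ 2 =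
      \sum_y \sum_z g y * g z * (1 + q * (y == z)%:R).
    rewrite expr2 mulr_suml mulr_sumr -big_split; apply: eq_bigr => y _ /=.
    under [RHS]eq_bigr do rewrite mulrDr mulr1.
    rewrite big_split /= mulr_sumr; congr (_ + _).
    rewrite (bigD1 y) //= big1 ?addr0 ?eqxx ?mulr1; first by ring.
    by move=> z; rewrite eq_sym => /negPf ->; rewrite !mulr0.
  apply: ler_sum => y _; apply: ler_sum => z _.
  have [[g0 _] [g0' _]] := (andP (g01 y), andP (g01 z)).
  by rewrite ler_wpM2l ?mulr_ge0 // common_incident.
have card2 : \sum_(y : F * F) 1 = q ^+ 2 :> R.
  by rewrite sumr_const card_prod natrM expr2.
have sumg2 : \sum_y g y ^+ 2 <= q ^+ 2.
  rewrite -card2; apply: ler_sum => y _.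
  by have /andP[? ?] := g01 y; rewrite expr_le1.
have dev : \sum_x (h x - s / q) ^+ 2 <= q ^+ 3.
  have -> : \sum_x (h x - s / q) ^+ 2 = \sum_x h x ^+ 2 - s ^+ 2.
    have E x : (h x - s / q) ^+ 2
        = h x ^+ 2 + ((- (2 * s / q)) * h x + (s / q) ^+ 2 * 1) by ring.
    under eq_bigr do rewrite E.
    rewrite !big_split /= -!mulr_sumr sumh card2; field.
    by rewrite gt_eqF.
  rewrite lerBlDl (le_trans sumh2) // lerD2l.
  by rewrite [_ ^+ 3]exprS ler_wpM2l // ltW.
(* Pass from squares to absolute values by 2 w |t| <= t^2 + w^2. *)
rewrite ler_pdivlMr // -(ler_pM2r (ltr0n R 2)).
have -> : q ^+ 3 * 2%:R = q ^+ 3 + q ^+ 2 * q by ring.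
apply: (@le_trans _ _ (\sum_x ((h x - s / q) ^+ 2 + w ^+ 2))).
  have -> : (\sum_x `|h x - s / q|) * w * 2
      = \sum_x `|h x - s / q| * w * 2 by rewrite -!mulr_suml.
  apply: ler_sum => x _; rewrite -(real_normK (num_real (h x - s / q))).
  by rewrite -subr_ge0 (_ : _ - _ = (`|h x - s / q| - w) ^+ 2) ?sqr_ge0; ring.
rewrite big_split /= lerD // -card2 mulr_suml ler_sum // => x _.
by rewrite mul1r.
Qed.

(** The relation with values in T is a disjoint union of #|T| translated
    incidence relations, over which the deviations add up.  Since the main term
    also grows like #|T|, the relative error is of order 1 / w however dense
    the relation is. *)
Lemma incidence_mixing (R : realFieldType) (F : finFieldType) (T : {set F})
    (w : R) (f g : F * F -> R) :
  0 < w -> w ^+ 2 <= #|F|%:R ->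
  (forall x, 0 <= f x <= 1) -> (forall x, 0 <= g x <= 1) ->
  `|\sum_x \sum_y f x * (x.2 + y.2 - x.1 * y.1 \in T)%:R * g y
     - #|T|%:R / #|F|%:R * (\sum_x f x) * (\sum_y g y)|
    <= #|T|%:R * (#|F|%:R ^+ 3 / w).
Proof.
move=> w0 wq f01 g01; set q : R := #|F|%:R; set s := \sum_y g y.
have inT (x y : F * F) : (x.2 + y.2 - x.1 * y.1 \in T)%:R
    = \sum_(t in T) (incident t x y)%:R :> R.
  rewrite /incident; set u := _ - _; have [uT|uT] := boolP (u \in T).
    rewrite (bigD1 u) //= eqxx big1 ?addr0 // => t /andP[_].
    by rewrite eq_sym => /negPf ->.
  by rewrite big1 // => t tT; case: eqP => // E; rewrite E tT in uT.
have -> : \sum_x \sum_y f x * (x.2 + y.2 - x.1 * y.1 \in T)%:R * g y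
     - #|T|%:R / q * (\sum_x f x) * s
   = \sum_(t in T) \sum_x f x * (\sum_y (incident t x y)%:R * g y - s / q).
  have -> : #|T|%:R / q * (\sum_x f x) * s = \sum_(t in T) \sum_x f x * (s / q).
    by rewrite sumr_const -mulr_suml -[RHS]mulr_natl; ring.
  have -> : \sum_x \sum_y f x * (x.2 + y.2 - x.1 * y.1 \in T)%:R * g y
      = \sum_(t in T) \sum_x f x * \sum_y (incident t x y)%:R * g y.
    rewrite [RHS]exchange_big; apply: eq_bigr => x _ /=.
    rewrite -[RHS]mulr_sumr [in RHS]exchange_big mulr_sumr; apply: eq_bigr => y _ /=.
    by rewrite inT -mulrA mulr_suml.
  rewrite -sumrB; apply: eq_bigr => t _.
  by rewrite -sumrB; apply: eq_bigr => x _; rewrite mulrBr.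
apply: le_trans (ler_norm_sum _ _ _) _.
rewrite mulr_natl -sumr_const; apply: ler_sum => t _.
apply: le_trans (incident_deviation t w0 wq g01).
apply: le_trans (ler_norm_sum _ _ _) _; apply: ler_sum => x _.
have /andP[f0 f1] := f01 x.
by rewrite normrM ger0_norm // ler_piMl.
Qed.

(** * Blowing up a matrix of densities to a graph *)

Section blowup.
Context (n : nat) (F : finFieldType) (T : 'I_n -> 'I_n -> {set F}).
Context (Tsym : forall a b, T a b = T b a).

(** The first component of a vertex is its block. *)
Definition blowup_adj (u v : 'I_n * (F * F)) : bool :=
  (u != v) && (u.2.2 + v.2.2 - u.2.1 * v.2.1 \in T u.1 v.1).

Definition blowup_edge : rel 'I_#|{: 'I_n * (F * F)}| :=
  fun x y => blowup_adj (enum_val x) (enum_val y).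

Lemma blowup_sym : symmetric blowup_edge.
Proof.
move=> x y; rewrite /blowup_edge /blowup_adj eq_sym Tsym.
by rewrite [_.2.2 + _]addrC [_.2.1 * _]mulrC.
Qed.

Lemma blowup_irr : irreflexive blowup_edge.
Proof. by move=> x; rewrite /blowup_edge /blowup_adj eqxx. Qed.

Definition blowup : sgraph := SGraph blowup_sym blowup_irr.

End blowup.

Lemma sum_pair (V : nmodType) (A B : finType) (G : A * B -> V) :
  \sum_u G u = \sum_a \sum_b G (a, b).
Proof. by rewrite pair_bigA; apply: eq_bigr => -[]. Qed.

(** Removing the loops changes at most one entry for each of the n q^2 vertices;
    the remaining error is that of the n^2 pairs of blocks. *)
Lemma blowup_mixing (R : realFieldType) (n : nat) (F : finFieldType)
    (T : 'I_n -> 'I_n -> {set F}) (w : R) (f g : 'I_n * (F * F) -> R) :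
  0 < w -> w ^+ 2 <= #|F|%:R ->
  (forall u, 0 <= f u <= 1) -> (forall u, 0 <= g u <= 1) ->
  `|\sum_u \sum_v f u * (blowup_adj T u v)%:R * g v
     - \sum_a \sum_b #|T a b|%:R / #|F|%:R * (\sum_x f (a, x)) * (\sum_y g (b, y))|
    <= n%:R * #|F|%:R ^+ 2 + n%:R ^+ 2 * (#|F|%:R ^+ 4 / w).
Proof.
move=> w0 wq f01 g01; set q : R := #|F|%:R.
pose P u v := (u.2.2 + v.2.2 - u.2.1 * v.2.1 \in T u.1 v.1).
have loops : `|\sum_u \sum_v f u * (blowup_adj T u v)%:R * g v
    - \sum_u \sum_v f u * (P u v)%:R * g v| <= n%:R * q ^+ 2.
  rewrite -sumrB; apply: le_trans (ler_norm_sum _ _ _) _.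
  have -> : n%:R * q ^+ 2 = \sum_(u : 'I_n * (F * F)) 1 :> R.
    by rewrite sumr_const !card_prod card_ord !natrM expr2.
  apply: ler_sum => u _; rewrite -sumrB (bigD1 u) //= big1 ?addr0.
    have /andP[f0 f1] := f01 u; have /andP[g0 g1] := g01 u.
    rewrite /blowup_adj eqxx /= mulr0 mul0r sub0r normrN ger0_norm; last first.
      by rewrite !mulr_ge0.
    case: (P u u); rewrite ?mulr0 ?mul0r // mulr1.
    by rewrite mulr_ile1.
  by move=> v; rewrite eq_sym /blowup_adj => -> /=; rewrite subrr.
have blocks : \sum_u \sum_v f u * (P u v)%:R * g v
   = \sum_a \sum_b \sum_x \sum_y f (a, x) *
        (x.2 + y.2 - x.1 * y.1 \in T a b)%:R * g (b, y).
  rewrite sum_pair; apply: eq_bigr => a _; rewrite [RHS]exchange_big.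
  by apply: eq_bigr => x _; rewrite sum_pair.
rewrite -(subrK (\sum_u \sum_v f u * (P u v)%:R * g v)
  (\sum_u \sum_v f u * (blowup_adj T u v)%:R * g v)) -addrA.
apply: le_trans (ler_normD _ _) _; apply: lerD => //.
rewrite blocks -sumrB; apply: le_trans (ler_norm_sum _ _ _) _.
have -> : n%:R ^+ 2 * (q ^+ 4 / w) = \sum_(a < n) \sum_(b < n) q * (q ^+ 3 / w).
  rewrite !sumr_const card_ord -mulrnA -[RHS]mulr_natl natrM; ring.
apply: ler_sum => a _; rewrite -sumrB; apply: le_trans (ler_norm_sum _ _ _) _.
apply: ler_sum => b _.
apply: (@le_trans _ _ (#|T a b|%:R * (q ^+ 3 / w))).
  exact: (incidence_mixing _ w0 wq).
by rewrite ler_wpM2r ?ler_nat ?max_card // divr_ge0 ?exprn_ge0 ?ler0n // ltW.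
Qed.

Definition block_avg (R : realFieldType) (n : nat) (F : finFieldType)
  (f : 'I_n * (F * F) -> R) (a : 'I_n) : R := (\sum_x f (a, x)) / #|F|%:R ^+ 2.

Lemma sum_block_const (R : realFieldType) (F : finFieldType) (c : R) :
  \sum_(x : F * F) c = #|F|%:R ^+ 2 * c.
Proof. by rewrite sumr_const card_prod -[LHS]mulr_natl natrM expr2. Qed.

(** Rounding q S_ab to the integer #|T a b| costs 1 / q in each density; the
    loops, the rounding and the deviation from randomness each contribute at
    most n^2 / w after division by q^4. *)
Lemma blowup_energy (R : realFieldType) (n : nat) (F : finFieldType)
    (T : 'I_n -> 'I_n -> {set F}) (S : 'I_n -> 'I_n -> R) (w : R)
    (f g : 'I_n * (F * F) -> R) :
  1 <= w -> w ^+ 2 <= #|F|%:R ->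
  (forall a b, `|#|T a b|%:R / #|F|%:R - S a b| <= #|F|%:R^-1) ->
  (forall u, 0 <= f u <= 1) -> (forall u, 0 <= g u <= 1) ->
  `|\sum_u \sum_v f u * (blowup_adj T u v)%:R * g v
     - #|F|%:R ^+ 4 * \sum_a \sum_b S a b * block_avg f a * block_avg g b|
    <= #|F|%:R ^+ 4 * (3 * n%:R ^+ 2 / w).
Proof.
move=> w1 wq TS f01 g01; set q : R := #|F|%:R in wq TS *.
have w0 : 0 < w by lra.
have wleq : w <= q by apply: le_trans wq; rewrite expr2 ler_peMl // ltW.
have q0 : 0 < q by lra.
set E := \sum_u _.
set E' := \sum_a \sum_b #|T a b|%:R / q * (\sum_x f (a, x)) * (\sum_y g (b, y)).
have bnd (h : 'I_n * (F * F) -> R) a : (forall u, 0 <= h u <= 1) ->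
    0 <= \sum_x h (a, x) <= q ^+ 2.
  move=> h01; apply/andP; split.
    by apply: sumr_ge0 => x _; have /andP[] := h01 (a, x).
  rewrite -[q ^+ 2]mulr1 -sum_block_const; apply: ler_sum => x _.
  by have /andP[] := h01 (a, x).
have -> : q ^+ 4 * (\sum_a \sum_b S a b * block_avg f a * block_avg g b)
    = \sum_a \sum_b S a b * (\sum_x f (a, x)) * (\sum_y g (b, y)).
  rewrite mulr_sumr; apply: eq_bigr => a _; rewrite mulr_sumr.
  apply: eq_bigr => b _; rewrite /block_avg -/q; field; exact: lt0r_neq0.
set E'' := \sum_a _.
have d1 : `|E - E'| <= n%:R * q ^+ 2 + n%:R ^+ 2 * (q ^+ 4 / w).
  exact: (blowup_mixing T w0 wq f01 g01).
have d2 : `|E' - E''| <= n%:R ^+ 2 * q ^+ 3.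
  rewrite /E' /E'' -sumrB; apply: le_trans (ler_norm_sum _ _ _) _.
  have -> : n%:R ^+ 2 * q ^+ 3 = \sum_(a < n) \sum_(b < n) q ^+ 3.
    by rewrite !sumr_const card_ord -mulrnA -[RHS]mulr_natl natrM; ring.
  apply: ler_sum => a _; rewrite -sumrB; apply: le_trans (ler_norm_sum _ _ _) _.
  apply: ler_sum => b _; rewrite -mulrBl -mulrBl !normrM.
  have /andP[x0 x1] := bnd f a f01; have /andP[y0 y1] := bnd g b g01.
  rewrite [X in _ * X * _]ger0_norm // [X in _ * X]ger0_norm //.
  have -> : q ^+ 3 = q^-1 * q ^+ 2 * q ^+ 2 by field; exact: lt0r_neq0.
  by apply: ler_pM => //; first exact: mulr_ge0; apply: ler_pM.
have nn : n%:R <= n%:R ^+ 2 :> R.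
  rewrite -natrX ler_nat; case: (n) => // m.
  by rewrite -[m.+1]expn1 -expnM leq_pexp2l.
have e1 : n%:R * q ^+ 2 <= n%:R ^+ 2 * (q ^+ 4 / w).
  apply: ler_pM => //; rewrite ?ler0n ?exprn_ge0 ?(ltW q0) //.
  rewrite ler_pdivlMr // (_ : q ^+ 4 = q ^+ 2 * q ^+ 2); last by ring.
  rewrite ler_wpM2l ?exprn_ge0 ?(ltW q0) //; apply: (le_trans wleq).
  by rewrite expr2 ler_peMl //; lra.
have e2 : n%:R ^+ 2 * q ^+ 3 <= n%:R ^+ 2 * (q ^+ 4 / w).
  rewrite ler_wpM2l ?exprn_ge0 ?ler0n // ler_pdivlMr // (_ : q ^+ 4 = q ^+ 3 * q).
    by rewrite ler_wpM2l ?exprn_ge0 ?(ltW q0).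
  by ring.
have -> : q ^+ 4 * (3 * n%:R ^+ 2 / w) = 3 * (n%:R ^+ 2 * (q ^+ 4 / w)) by ring.
have -> : E - E'' = (E - E') + (E' - E'') by ring.
apply: le_trans (ler_normD _ _) _; lra.
Qed.

(** C_0 divides by the total weight W of the graph, which is itself only known
    up to a relative error. *)
Lemma ratio_close (R : realFieldType) (c eta X W s : R) :
  0 < c -> eta <= 1 / 2 -> 0 <= s <= 1 ->
  `|X - c * s| <= c * eta -> `|W - c| <= c * eta ->
  `|W^-1 * X - s| <= 4 * eta.
Proof.
move=> c0 eta2 /andP[s0 s1] hX hW.
have ce : c * eta <= c / 2 by rewrite ler_pM2l //; lra.
have W0 : c / 2 <= W by move: hW; rewrite ler_distl => /andP[]; lra.
have Wpos : 0 < W by lra.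
have -> : W^-1 * X - s = W^-1 * (X - W * s) by field; exact: lt0r_neq0.
rewrite normrM gtr0_norm ?invr_gt0 // mulrC ler_pdivrMr //.
have -> : X - W * s = (X - c * s) - (W - c) * s by ring.
apply: le_trans (ler_normB _ _) _; rewrite normrM (ger0_norm s0).
have h1 : `|W - c| * s <= c * eta.
  by apply: le_trans hW; rewrite ler_piMr.
have eta0 : 0 <= eta.
  by rewrite -(pmulr_rge0 _ c0); apply: le_trans hW.
have : 4 * eta * (c / 2) <= 4 * eta * W by rewrite ler_wpM2l // mulr_ge0.
lra.
Qed.

Lemma set_of_card (F : finType) (t : nat) : (t <= #|F|)%N ->
  exists T : {set F}, #|T| = t.
Proof.
move=> tF; exists [set x in take t (enum F)].
rewrite cardsE (card_uniqP _) ?take_uniq ?enum_uniq //.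
by rewrite size_take_min -cardE; apply/minn_idPl.
Qed.

Lemma mulmx_energy (R : pzSemiRingType) (k n : nat) (M : 'M[R]_(k, n))
    (S : 'M[R]_n) i j :
  (M *m S *m M^T) i j = \sum_a \sum_b M i a * S a b * M j b.
Proof.
rewrite mxE exchange_big; apply: eq_bigr => b _ /=.
by rewrite !mxE mulr_suml.
Qed.

Lemma Kmx_le1 (R : realType) (k n : nat) (M : 'M[R]_(k, n)) i a :
  Kmx M -> 0 <= M i a <= 1.
Proof.
move=> [M0 _ Mc]; rewrite M0 /= -(Mc a) (bigD1 i) //= lerDl.
by apply: sumr_ge0.
Qed.

Definition entrywise_close (R : numDomainType) (k : nat) (e : R)
  (A B : 'M[R]_k) := forall i j, `|A i j - B i j| <= e.

(** Block averages map [Kmx k (n q^2)] onto [Kmx k n], with the block-constant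
    matrices as a section, and [blowup_energy] says that energies are almost
    preserved.  The error bound does not involve k, so one graph serves all k;
    the norm of the adjacency matrix is estimated by the same bound, as the
    energy of constant functions. *)
Lemma graph_of_matrix (R : realType) (n : nat) (S : 'M[R]_n) (e : R) :
  0 < e -> (forall a b, 0 <= S a b) -> (forall a b, S a b = S b a) ->
  \sum_a \sum_b S a b = 1 ->
  exists2 G : sgraph, has_edge G & forall k, (0 < k)%N ->
    (forall A, C0 R G k A -> exists2 B, Cmx S k B & entrywise_close e A B) /\
    (forall B, Cmx S k B -> exists2 A, C0 R G k A & entrywise_close e A B).
Proof.
move=> e0 S0 Ssym S1.
have Sle1 a b : S a b <= 1.
  rewrite -S1 (bigD1 a) //= (bigD1 b) //= -addrA lerDl.
  by rewrite addr_ge0 ?sumr_ge0 // => *; exact: sumr_ge0.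
(* The second summand of w makes 4 eta at most e, the third makes eta at most
   1 / 2. *)
pose w : R := 1 + 12 * n%:R ^+ 2 / e + 6 * n%:R ^+ 2.
have n20 : 0 <= n%:R ^+ 2 :> R by rewrite exprn_ge0.
have ne0 : 0 <= 12 * n%:R ^+ 2 / e by rewrite divr_ge0 ?mulr_ge0 // ltW.
have w1 : 1 <= w by rewrite /w; lra.
have w0 : 0 < w by lra.
pose eta := 3 * n%:R ^+ 2 / w.
have eta2 : eta <= 1 / 2 by rewrite ler_pdivrMr //; rewrite /w; lra.
have etae : 4 * eta <= e.
  rewrite /eta !mulrA ler_pdivrMr // [e * w]mulrC -ler_pdivrMr //.
  apply: (@le_trans _ _ (12 * n%:R ^+ 2 / e)); last by rewrite /w; lra.
  by rewrite ler_wpM2r ?invr_ge0 ?(ltW e0) //; lra.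
(* Any field with at least w^2 elements will do. *)
have [p wp pp] := prime_above (Num.truncn (w ^+ 2)).
have wq : w ^+ 2 <= #|'F_p|%:R :> R.
  rewrite card_Fp //; apply: (@le_trans _ _ (Num.truncn (w ^+ 2)).+1%:R).
    by have /andP[_ /ltW] := truncn_itv (sqr_ge0 w).
  by rewrite ler_nat.
set q : R := #|'F_p|%:R in wq.
have q0 : 0 < q by apply: lt_le_trans wq; rewrite exprn_gt0.
have /choice [T0 T0S] (ab : 'I_n * 'I_n) : exists T : {set 'F_p},
    #|T| = Num.truncn (S ab.1 ab.2 * q).
  apply: set_of_card; rewrite -(ler_nat R) -/q.
  apply: (@le_trans _ _ (S ab.1 ab.2 * q)); last by rewrite ler_piMl // ltW.
  by rewrite truncn_le mulr_ge0 // ltW.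
(* The sets are chosen arbitrarily for a <= b and copied, to get a symmetric
   relation. *)
pose T (a b : 'I_n) := if (a <= b)%N then T0 (a, b) else T0 (b, a).
have Tsym a b : T a b = T b a.
  rewrite /T; case: ltngtP => // E; congr T0; congr (_, _);
    by apply/val_inj; rewrite /= E.
have Tcard a b : #|T a b| = Num.truncn (S a b * q).
  by rewrite /T; case: ifP => _; rewrite T0S //= Ssym.
have TS a b : `|#|T a b|%:R / q - S a b| <= q^-1.
  rewrite Tcard -[S a b](mulfK (lt0r_neq0 q0)) -mulrBl mulfK ?lt0r_neq0 //.
  rewrite normrM [X in _ * X]gtr0_norm ?invr_gt0 // ler_piMl ?invr_ge0 ?(ltW q0) //.
  have /andP[t1 t2] := truncn_itv (mulr_ge0 (S0 a b) (ltW q0)).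
  rewrite distrC ger0_norm ?subr_ge0 // lerBlDl; move: t2.
  by rewrite -natr1 addrC => /ltW; rewrite addrC.
have energy := blowup_energy w1 wq TS; rewrite -/eta -/q in energy.
pose G := blowup Tsym.
pose V := ('I_n * ('F_p * 'F_p))%type.
have reidx (h : 'I_(gorder G) -> R) : \sum_x h x = \sum_(u : V) h (enum_rank u).
  by apply: (reindex (@enum_rank V)); apply: onW_bij; exact: enum_rank_bij.
have adjE (u v : V) : adjmx R G (enum_rank u) (enum_rank v) = (blowup_adj T u v)%:R.
  by rewrite mxE /= /blowup_edge !enum_rankK.
pose one (u : V) : R := 1.
have one01 u : 0 <= one u <= 1 by rewrite /one ler01 lexx.
have avg1 a : block_avg one a = 1.
  by rewrite /block_avg sum_block_const mulr1 divff // expf_neq0 // lt0r_neq0.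
have normA : `|mxl1 (adjmx R G) - q ^+ 4| <= q ^+ 4 * eta.
  have := energy one one one01 one01.
  have -> : \sum_a \sum_b S a b * block_avg one a * block_avg one b = 1.
    by rewrite -S1; do 2!apply: eq_bigr => ? _; rewrite !avg1 !mulr1.
  rewrite mulr1; congr (`|_ - _| <= _).
  rewrite /mxl1 reidx; apply: eq_bigr => u _; rewrite reidx.
  by apply: eq_bigr => v _; rewrite adjE mul1r mulr1 ger0_norm.
have c0 : 0 < q ^+ 4 by rewrite exprn_gt0.
have cmp k (M : 'M[R]_(k, gorder G)) (M' : 'M[R]_(k, n)) : Kmx M -> Kmx M' ->
    (forall i a, M' i a = block_avg (fun u : V => M i (enum_rank u)) a) ->
    entrywise_close e ((mxl1 (adjmx R G))^-1 *: (M *m adjmx R G *m M^T))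
       (M' *m S *m M'^T).
  move=> KM KM' MM' i j; apply: le_trans etae.
  rewrite mxE; apply: (ratio_close c0 eta2 _ _ normA).
    rewrite mulmx_energy; apply/andP; split.
      apply: sumr_ge0 => a _; apply: sumr_ge0 => b _.
      by rewrite !mulr_ge0 //; case: KM'.
    rewrite -S1; apply: ler_sum => a _; apply: ler_sum => b _.
    have /andP[x0 x1] := Kmx_le1 i a KM'; have /andP[y0 y1] := Kmx_le1 j b KM'.
    rewrite -[leRHS]mul1r -[leRHS]mulr1.
    by apply: ler_pM => //; [exact: mulr_ge0|apply: ler_pM].
  have := energy (fun u => M i (enum_rank u)) (fun u => M j (enum_rank u))
     (fun u => Kmx_le1 _ _ KM) (fun u => Kmx_le1 _ _ KM).
  congr (`|_ - _| <= _).
    rewrite mulmx_energy reidx; apply: eq_bigr => u _; rewrite reidx.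
    by apply: eq_bigr => v _; rewrite adjE.
  congr (_ * _); rewrite mulmx_energy; apply: eq_bigr => a _.
  by apply: eq_bigr => b _; rewrite !MM'; ring.
exists G.
  have : 0 < mxl1 (adjmx R G).
    move: normA; rewrite ler_distl => /andP[+ _]; apply: lt_le_trans.
    have : q ^+ 4 * eta <= q ^+ 4 / 2 by rewrite ler_pM2l //; lra.
    lra.
  apply: contraPP => nE; apply/negP; rewrite -leNgt /mxl1.
  rewrite big1 // => x _; rewrite big1 // => y _; rewrite mxE.
  by case: (boolP (gedge x y)) => [xy|_];
    [case: nE; exists x, y|rewrite normr0].
have NE : (gorder G)%:R = n%:R * q ^+ 2 :> R.
  by rewrite /= !card_prod card_ord !natrM expr2.
move=> k k0; have kR : k%:R != 0 :> R by rewrite pnatr_eq0 -lt0n.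
split.
- move=> _ [_ [M KM <-] <-]; have [M0 Mr Mc] := KM.
  pose M' : 'M[R]_(k, n) :=
    \matrix_(i, a) block_avg (fun u : V => M i (enum_rank u)) a.
  have KM' : Kmx M'.
    split.
    + move=> i a; rewrite mxE divr_ge0 ?exprn_ge0 ?(ltW q0) //.
      by apply: sumr_ge0 => x _.
    + move=> i; transitivity ((\sum_x M i x) / q ^+ 2).
        rewrite reidx sum_pair mulr_suml; apply: eq_bigr => a _.
        by rewrite mxE.
      by rewrite Mr NE; field; rewrite kR lt0r_neq0.
    + move=> a; transitivity (block_avg one a); last exact: avg1.
      rewrite /block_avg -/q mulr_suml.
      under eq_bigr do rewrite mxE /block_avg mulr_suml.
      rewrite exchange_big; apply: eq_bigr => x _ /=.
      by rewrite -mulr_suml Mc.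
  exists (M' *m S *m M'^T); first by exists M'.
  by apply: cmp => // i a; rewrite mxE.
- move=> _ [M' KM' <-]; have [M0 Mr Mc] := KM'.
  pose M : 'M[R]_(k, gorder G) := \matrix_(i, x) M' i (enum_val x).1.
  have ME i (u : V) : M i (enum_rank u) = M' i u.1 by rewrite mxE enum_rankK.
  have KM : Kmx M.
    split.
    + by move=> i x; rewrite mxE.
    + move=> i; rewrite reidx sum_pair NE.
      under eq_bigr => a _ do under eq_bigr => x _ do rewrite ME /=.
      under eq_bigr => a _ do rewrite sum_block_const.
      by rewrite -mulr_sumr Mr -/q; ring.
    + by move=> x; under eq_bigr do rewrite mxE; exact: Mc.
  exists ((mxl1 (adjmx R G))^-1 *: (M *m adjmx R G *m M^T)).
    by exists (M *m adjmx R G *m M^T) => //; exists M.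
  apply: cmp => // i a; rewrite /block_avg -/q.
  under eq_bigr do rewrite ME /=.
  by rewrite sum_block_const mulrC mulKf // expf_neq0 // lt0r_neq0.
Qed.

(** * Step functions on a uniform grid are dense *)

Section cells.
Context {R : realType} {n : nat}.
Implicit Types (a b : 'I_n.+1) (x y : measurableTypeR R).

(** Every cell contains its left end point only, except that the last one is
    closed: the cells partition the closed unit interval, which matters because
    mu may charge end points. *)
Definition cell_itv a : interval R :=
  Interval (BLeft (a%:R / n.+1%:R)) (BSide (a != ord_max) (a.+1%:R / n.+1%:R)).

Definition cell a : set (measurableTypeR R) := [set` cell_itv a].

Lemma measurable_cell a : measurable (cell a).
Proof. exact: measurable_itv. Qed.

Lemma cellP a x : cell a x <->
  (a%:R <= n.+1%:R * x) /\ (n.+1%:R * x < a.+1%:R \/ (a = ord_max /\ x = 1)).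
Proof.
have n0 : 0 < n.+1%:R :> R by rewrite ltr0n.
rewrite /cell /= in_itv /= ler_pdivrMr // [x * _]mulrC.
have [->|na] := eqVneq a ord_max; rewrite /= /Order.lteif /=.
  rewrite divff ?lt0r_neq0 //; split.
    case/andP => -> x1; split => //; move: x1; rewrite le_eqVlt => /orP[/eqP ->|x1].
      by right.
    by left; rewrite -[ltRHS]mulr1 ltr_pM2l.
  case=> -> [h|[_ ->]] /=; last exact: lexx.
  by move: h; rewrite -[ltRHS]mulr1 ltr_pM2l // => /ltW.
rewrite ltr_pdivlMr // [x * _]mulrC; split.
  by case/andP => ? ?; split => //; left.
by case=> -> [//|[e _]]; rewrite e eqxx in na.
Qed.

Lemma cell_unitI a : cell a `<=` unitI R.
Proof.
have n0 : 0 < n.+1%:R :> R by rewrite ltr0n.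
move=> x /cellP[h1 h2]; rewrite /unitI /= in_itv /=; apply/andP; split.
  by rewrite -(pmulr_rge0 _ n0); apply: le_trans h1.
case: h2 => [h2|[_ ->//]]; rewrite -(ler_pM2l n0) mulr1.
by apply: (le_trans (ltW h2)); rewrite ler_nat.
Qed.

Lemma cell_cover x : unitI R x -> exists a, cell a x.
Proof.
rewrite /unitI /= in_itv /= => /andP[x0 x1].
have n0 : 0 < n.+1%:R :> R by rewrite ltr0n.
have [->|xn1] := eqVneq x 1.
  by exists ord_max; apply/cellP; rewrite mulr1 ler_nat; split; [|right].
have nx0 : 0 <= n.+1%:R * x by rewrite mulr_ge0 // ltW.
have tn : (Num.truncn (n.+1%:R * x) < n.+1)%N.
  by rewrite truncn_lt_nat // -[ltRHS]mulr1 ltr_pM2l // lt_neqAle xn1.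
have /andP[t1 t2] := truncn_itv nx0.
by exists (Ordinal tn); apply/cellP; split => //; left.
Qed.

Lemma cell_inj a b x : cell a x -> cell b x -> a = b.
Proof.
wlog ab : a b / (a <= b)%N => [H ha hb|].
  by case: (leqP a b) => [|/ltnW] ab; [exact: H|symmetry; exact: H].
move=> /cellP[_ ha] /cellP[hb _]; apply/val_inj/eqP.
rewrite /= eqn_leq ab /=; case: ha => [ha|[-> _]]; last by rewrite -ltnS.
by have := le_lt_trans hb ha; rewrite ltr_nat ltnS.
Qed.

Lemma cell_diam a x y : cell a x -> cell a y -> x <= y + n.+1%:R^-1.
Proof.
have n0 : 0 < n.+1%:R :> R by rewrite ltr0n.
move=> /cellP[_ hx] /cellP[hy _].
rewrite -(ler_pM2l n0) mulrDr divff ?lt0r_neq0 //.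
have : n.+1%:R * x <= a.+1%:R by case: hx => [/ltW //|[-> ->]]; rewrite mulr1.
by move=> h; apply: (le_trans h); rewrite -natr1 lerD2r.
Qed.

Lemma lebesgue_measure_cell a : lebesgue_measure (cell a) = (n.+1%:R^-1)%:E.
Proof.
have n0 : 0 < n.+1%:R :> R by rewrite ltr0n.
rewrite /cell lebesgue_measure_itv /= lte_fin ltr_pM2r ?invr_gt0 // ltr_nat ltnSn.
by rewrite -EFinB -mulrBl -natr1 addrAC subrr add0r mul1r.
Qed.

Definition step (c : 'I_n.+1 -> R) x : R := \sum_a c a * \1_(cell a) x.

Lemma stepE c a x : cell a x -> step c x = c a.
Proof.
move=> ax; rewrite /step (bigD1 a) //= big1 => [|b ba].
  by rewrite indicE mem_set // mulr1 addr0.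
rewrite indicE memNset ?mulr0 // => bx.
by rewrite (cell_inj bx ax) eqxx in ba.
Qed.

Lemma measurable_step c D : measurable_fun D (step c).
Proof.
apply: measurable_sum => a; apply: measurable_funM => //.
exact: measurable_indic (measurable_cell a).
Qed.

End cells.

Lemma measurable_unitI (R : realType) : measurable (unitI R).
Proof. exact: measurable_itv. Qed.
#[global] Hint Resolve measurable_unitI : core.

Lemma measurable_EFin_norm_sub d (T : measurableType d) (R : realType)
    (D : set T) (f g : T -> R) : measurable_fun D f -> measurable_fun D g ->
  measurable_fun D (fun x => `|f x - g x|%:E).
Proof.
move=> mf mg; apply/measurable_EFinP; apply: measurableT_comp => //.
exact: measurable_funB.
Qed.

Section density.
Context {R : realType} (m : {measure set (measurableTypeR R) -> \bar R}).
Context (mfin : (m (unitI R) < +oo)%E).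
Implicit Types f g h : measurableTypeR R -> R.

Definition L1dist (f g : measurableTypeR R -> R) : \bar R :=
  (\int[m]_(x in unitI R) `|f x - g x|%:E)%E.

(** Approximation is required at every sufficiently fine level, so that finitely
    many functions can be approximated on a common grid. *)
Definition step_approximable f := forall e : R, 0 < e ->
  \forall n \near \oo, exists c : 'I_n.+1 -> R, (L1dist f (step c) <= e%:E)%E.

Lemma L1dist_le_add f g h f' g' h' f'' g'' :
  measurable_fun (unitI R) f -> measurable_fun (unitI R) f' ->
  measurable_fun (unitI R) g -> measurable_fun (unitI R) g' ->
  measurable_fun (unitI R) h -> measurable_fun (unitI R) h' ->
  (forall x, unitI R x ->
     `|h x - h' x| <= `|f x - f' x| + `|g x - g' x|) ->
  (L1dist h h' <= L1dist f f' + L1dist g g')%E.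
Proof.
move=> mf mf' mg mg' mh mh' le; rewrite /L1dist -ge0_integralD //;
  [|exact: measurable_EFin_norm_sub|exact: measurable_EFin_norm_sub].
apply: ge0_le_integral => //; first exact: measurable_EFin_norm_sub.
by apply: emeasurable_funD; exact: measurable_EFin_norm_sub.
Qed.

Lemma L1dist_le_scale r f g h h' : 0 <= r ->
  measurable_fun (unitI R) f -> measurable_fun (unitI R) g ->
  measurable_fun (unitI R) h -> measurable_fun (unitI R) h' ->
  (forall x, unitI R x -> `|h x - h' x| <= r * `|f x - g x|) ->
  (L1dist h h' <= r%:E * L1dist f g)%E.
Proof.
move=> r0 mf mg mh mh' le; rewrite /L1dist -ge0_integralZl_EFin //;
  last exact: measurable_EFin_norm_sub.
apply: ge0_le_integral => //; first exact: measurable_EFin_norm_sub.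
by apply: emeasurable_funM => //; exact: measurable_EFin_norm_sub.
Qed.

Lemma L1dist_le_cst r f g : 0 <= r ->
  measurable_fun (unitI R) f -> measurable_fun (unitI R) g ->
  (forall x, unitI R x -> `|f x - g x| <= r) ->
  (L1dist f g <= r%:E * m (unitI R))%E.
Proof.
move=> r0 mf mg le; rewrite -integral_cst //.
by apply: ge0_le_integral => //; exact: measurable_EFin_norm_sub.
Qed.

Lemma L1dist_le_indic (E : set (measurableTypeR R)) f g : measurable E ->
  measurable_fun (unitI R) f -> measurable_fun (unitI R) g ->
  (forall x, unitI R x -> `|f x - g x| <= \1_E x) ->
  (L1dist f g <= m (E `&` unitI R))%E.
Proof.
move=> mE mf mg le; rewrite -integral_indic //.
apply: ge0_le_integral => //; first exact: measurable_EFin_norm_sub.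
exact/measurable_EFinP/measurable_indic.
Qed.

Lemma step_approxD f g :
  measurable_fun (unitI R) f -> measurable_fun (unitI R) g ->
  step_approximable f -> step_approximable g -> step_approximable (f \+ g).
Proof.
move=> mf mg af ag e e0; have e20 : 0 < e / 2 by rewrite divr_gt0.
near=> n; have [c hc] : exists c : 'I_n.+1 -> R,
    (L1dist f (step c) <= (e / 2)%:E)%E.
  by near: n; exact: af.
have [d hd] : exists c : 'I_n.+1 -> R, (L1dist g (step c) <= (e / 2)%:E)%E.
  by near: n; exact: ag.
exists (c \+ d); rewrite [e]splitr EFinD; apply: le_trans (leeD hc hd).
apply: L1dist_le_add => //; try exact: measurable_step; first exact: measurable_funD.
move=> x _; suff -> : step (c \+ d) x = step c x + step d x.
  by rewrite /= opprD addrACA ler_normD.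
by rewrite /step -big_split; apply: eq_bigr => a _ /=; rewrite mulrDl.
Unshelve. all: end_near. Qed.

Lemma step_approxZ r f : measurable_fun (unitI R) f ->
  step_approximable f -> step_approximable (fun x => r * f x).
Proof.
move=> mf af e e0; pose r1 := `|r| + 1.
have r10 : 0 < r1 by rewrite /r1 ltr_wpDl.
near=> n; have [c hc] : exists c : 'I_n.+1 -> R,
    (L1dist f (step c) <= (e / r1)%:E)%E.
  by near: n; apply: af; rewrite divr_gt0.
exists (fun a => r * c a).
apply: (@le_trans _ _ (r1%:E * L1dist f (step c))%E).
  apply: L1dist_le_scale => //; try exact: measurable_step; first exact: ltW.
    by apply: measurable_funM.
  move=> x _; have -> : step (fun a => r * c a) x = r * step c x.
    by rewrite /step mulr_sumr; apply: eq_bigr => a _; rewrite mulrA.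
  by rewrite -mulrBr normrM ler_wpM2r // /r1 lerDl.
apply: (@le_trans _ _ (r1%:E * (e / r1)%:E)%E); first by rewrite lee_pmul2l.
by rewrite -EFinM mulrC divfK // lt0r_neq0.
Unshelve. all: end_near. Qed.

Lemma step_approx_closed f : measurable_fun (unitI R) f ->
  (forall e : R, 0 < e -> exists g, [/\ measurable_fun (unitI R) g,
     step_approximable g & (L1dist f g <= e%:E)%E]) ->
  step_approximable f.
Proof.
move=> mf H e e0; have e20 : 0 < e / 2 by rewrite divr_gt0.
have [g [mg ag fg]] := H _ e20.
near=> n; have [c hc] : exists c : 'I_n.+1 -> R,
    (L1dist g (step c) <= (e / 2)%:E)%E.
  by near: n; exact: ag.
exists c; rewrite [e]splitr EFinD; apply: le_trans (leeD fg hc).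
apply: L1dist_le_add => //; try exact: measurable_step.
by move=> x _; apply: le_trans (ler_normD _ _); rewrite addrA subrK.
Unshelve. all: end_near. Qed.

Lemma vanishing_measure (E : nat -> set (measurableTypeR R)) :
  (forall n, measurable (E n)) -> {homo E : i j / (i <= j)%N >-> j `<=` i} ->
  (forall x, unitI R x -> exists n, ~ E n x) ->
  forall e : R, 0 < e -> \forall n \near \oo, (m (E n `&` unitI R) <= e%:E)%E.
Proof.
move=> mE dE E0 e e0.
have mEI n : measurable (E n `&` unitI R) by apply: measurableI.
have cvg : (m \o (fun n => E n `&` unitI R)) @ \oo
    --> m (\bigcap_n (E n `&` unitI R)).
  apply: nonincreasing_cvg_mu => //.
  - apply: le_lt_trans mfin; apply: le_measure; rewrite ?inE //.
  - exact: bigcapT_measurable.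
  - by move=> i j ij; apply/subsetPset; apply: setSI; exact: dE.
have I0 : \bigcap_n (E n `&` unitI R) = set0.
  rewrite -subset0 => x Ix; have [n] := E0 x (Ix 0%N I).2.
  by apply; exact: (Ix n I).1.
rewrite I0 measure0 in cvg.
have e0E : (0 < e%:E)%E by rewrite lte_fin.
have /cvg : nbhs (0%E : \bar R) [set y | (y < e%:E)%E].
  by apply: open_nbhs_nbhs; split => //; exact: open_ereal_lt_ereal.
by apply: (@filterS _ \oo) => n /= /ltW.
Qed.

(** Use the cells contained in the ray.  The points of the ray that are missed
    lie within one cell length of its end point r but differ from r, so their
    measure tends to 0 even if m has an atom at r. *)
Lemma step_approx_ray (r : R) : step_approximable (\1_(`]r, +oo[%classic)).
Proof.
move=> e e0.
pose E (n : nat) : set (measurableTypeR R) := `]r, r + n.+1%:R^-1]%classic.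
have vE : \forall n \near \oo, (m (E n `&` unitI R) <= e%:E)%E.
  apply: vanishing_measure => //.
  - by move=> n; exact: measurable_itv.
  - move=> i j ij x; rewrite /E /= !in_itv /= => /andP[-> /= h].
    apply: le_trans h _; rewrite lerD2l lef_pV2 ?posrE ?ltr0n // ler_nat //.
  - move=> x _; have [xr|rx] := leP x r.
      by exists 0%N; rewrite /E /= in_itv /= ltNge xr.
    move: rx; rewrite -subr_gt0 => rx.
    have [n _ /(_ n (leqnn n))] := near_infty_natSinv_lt (PosNum rx).
    rewrite /= => h; exists n; rewrite /E /= in_itv /= => /andP[_].
    by rewrite leNgt -ltrBrDl h.
near=> n; exists (fun a => (`[< cell a `<=` `]r, +oo[%classic >])%:R).
have mEn : measurable (E n) by exact: measurable_itv.
apply: (@le_trans _ _ (m (E n `&` unitI R))); last by near: n.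
apply: L1dist_le_indic => //; last move=> x Ix.
- exact: measurable_step.
have [a ax] := @cell_cover _ n _ Ix.
rewrite (stepE _ ax); case: asboolP => [ar|nar].
  by rewrite indicE mem_set ?subrr ?normr0 //; exact: ar.
rewrite subr0 ger0_norm // !indicE.
have [|] := boolP (x \in `]r, +oo[%classic) => //.
rewrite inE /= in_itv /= andbT => rx.
rewrite mem_set // /E /= in_itv /= rx /=.
apply: contra_notT nar; rewrite -ltNge => rnx y ay.
rewrite /= in_itv /= andbT.
by rewrite -(ltrD2r n.+1%:R^-1); apply: lt_le_trans rnx (cell_diam ax ay).
Unshelve. all: end_near. Qed.

(** Rays are stable under intersection and generate the Borel sets, and the
    approximable sets are stable under complement and countable disjoint union
    because m is finite. *)
Lemma step_approx_indic (A : set (measurableTypeR R)) : measurable A ->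
  step_approximable \1_A.
Proof.
have RG := @RGenOInfty.measurableE R.
move=> mA; have sA : <<s @RGenOInfty.G R >> A.
  have : (@ocitv R).-sigma.-measurable A by [].
  by rewrite RG.
 apply: (@dynkin_induction _ (measurableTypeR R)
  (@RGenOInfty.G R) (fun A => step_approximable \1_A)) => //.
- move=> _ _ [x ->] [y ->]; exists (Num.max x y).
  apply/seteqP; split => z /=; rewrite !in_itv /= !andbT gt_max.
    by case=> -> ->.
  by move/andP.
- move=> e e0; near=> n; exists (fun=> 1).
  apply: (@le_trans _ _ (0%:E * m (unitI R))%E);
    last by rewrite mul0e lee_fin ltW.
  apply: L1dist_le_cst => //; first exact: measurable_step.
  move=> x Ix; have [a ax] := @cell_cover _ n _ Ix.
  by rewrite (stepE _ ax) indicE mem_set // subrr normr0.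
- by move=> _ [x ->]; exact: step_approx_ray.
- move=> B mB aB e e0; near=> n.
  have [c hc] : exists c : 'I_n.+1 -> R, (L1dist \1_B (step c) <= e%:E)%E.
    by near: n; exact: aB.
  exists (fun a => 1 - c a); apply: le_trans hc; rewrite -[leRHS]mul1e.
  apply: L1dist_le_scale => //; try exact: measurable_step.
    by apply: measurable_indic; exact: measurableC.
  move=> x Ix; have [a ax] := @cell_cover _ n _ Ix.
  rewrite !(stepE _ ax) mul1r !indicE in_setC; case: (x \in B) => /=.
    by rewrite sub0r normrN.
  by rewrite sub0r normrN opprB addrC subrK.
- move=> F mF tF aF.
  have dF n : \big[setU/set0]_(k < n) F k `&` F n = set0.
    by apply: (@trivIset_bigsetUI _ predT) => //; rewrite /predT /= trueE.
  have mU : measurable (\bigcup_k F k) by exact: bigcup_measurable.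
  have mUn n : measurable (\big[setU/set0]_(k < n) F k).
    exact: bigsetU_measurable.
  apply: step_approx_closed; first exact: measurable_indic.
  move=> e e0.
  have [N _ /(_ N (leqnn N))] : \forall n \near \oo,
    (m ((\bigcup_k F k `\` \big[setU/set0]_(k < n) F k) `&` unitI R) <= e%:E)%E.
    apply: vanishing_measure => //.
    + by move=> n; exact: measurableD.
    + move=> i j ij; apply: setDS.
      by rewrite -!bigcup_mkord; apply: bigcup_subset => k /= /leq_trans; apply.
    + move=> x _; have [[k _ Fkx]|nF] := pselect ((\bigcup_k F k) x).
        exists k.+1; rewrite -bigcup_mkord => -[_]; apply; exists k => //=.
      by exists 0%N; case.
  rewrite /= => hN.
  exists \1_(\big[setU/set0]_(k < N) F k); split.
  + exact: measurable_indic.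
  + elim: (N) => [|n IHn].
      rewrite big_ord0; move=> d d0; near=> n; exists (fun=> 0).
      apply: (@le_trans _ _ (0%:E * m (unitI R))%E);
    last by rewrite mul0e lee_fin ltW.
      apply: L1dist_le_cst => //; first exact: measurable_step.
      move=> x Ix; have [a ax] := @cell_cover _ n _ Ix.
      by rewrite (stepE _ ax) indicE in_set0 subrr normr0.
    rewrite big_ord_recr /=.
    rewrite (_ : \1_(_ `|` F n) = \1_(\big[setU/set0]_(k < n) F k) \+ \1_(F n)).
      by apply: step_approxD => //; exact: measurable_indic.
    apply/funext => x; rewrite /= !indicE in_setU.
    have [xU|] := boolP (x \in \big[setU/set0]_(k < n) F k); last by rewrite add0r.
    have [xF|] := boolP (x \in F n); last by rewrite addr0.
    have : x \in \big[setU/set0]_(k < n) F k `&` F n by rewrite in_setI xU.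
    by rewrite dF in_set0.
  + apply: le_trans hN; apply: L1dist_le_indic; try exact: measurable_indic.
      by apply: measurableD => //; exact: mUn.
    move=> x _; rewrite !indicE in_setD.
    have [xU|xU] := boolP (x \in \big[setU/set0]_(k < N) F k).
      have -> : x \in \bigcup_k F k.
        move: xU; rewrite !inE -bigcup_mkord; apply: bigcup_subset => //.
      by rewrite subrr normr0.
    by rewrite subr0 andbT ger0_norm.
Unshelve. all: end_near. Qed.

Lemma step_approx_sum (N : nat) (r : R) (A : nat -> set (measurableTypeR R)) :
  (forall l, measurable (A l)) ->
  step_approximable (fun x => \sum_(l < N) r * \1_(A l) x).
Proof.
move=> mA; elim: N => [|N IHN].
  rewrite (_ : (fun _ => _) = (fun x => 0 * \1_(A 0%N) x)).
    by apply: step_approxZ; [exact: measurable_indic|exact: step_approx_indic].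
  by apply/funext => x; rewrite big_ord0 mul0r.
rewrite (_ : (fun _ => _) = (fun x => \sum_(l < N) r * \1_(A l) x)
   \+ (fun x => r * \1_(A N) x)); last first.
  by apply/funext => x /=; rewrite big_ord_recr.
apply: step_approxD => //.
- by apply: measurable_sum => l; apply: measurable_funM => //; exact: measurable_indic.
- by apply: measurable_funM => //; exact: measurable_indic.
- by apply: step_approxZ; [exact: measurable_indic|exact: step_approx_indic].
Qed.

(** Layer cake: the floor of N f, divided by N, is an average of N indicators of
    superlevel sets and is within 1 / N of f. *)
Lemma step_approx_unit f : measurable_fun (unitI R) f ->
  (forall x, unitI R x -> 0 <= f x <= 1) -> step_approximable f.
Proof.
move=> mf f01; apply: step_approx_closed => // e e0.
have mI : m (unitI R) \is a fin_num by rewrite ge0_fin_numE.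
pose C := fine (m (unitI R)); have C0 : 0 <= C by rewrite fine_ge0.
(* An error of 1 / N on a space of mass C must not exceed e. *)
pose N := (Num.truncn (C / e)).+1.
have N0 : 0 < N%:R :> R by rewrite ltr0n.
have CN : N%:R^-1 * C <= e.
  rewrite mulrC ler_pdivrMr // mulrC -ler_pdivrMr //.
  by have /andP[_ /ltW] := truncn_itv (divr_ge0 C0 (ltW e0)).
pose A (l : nat) := unitI R `&` f @^-1` `[l.+1%:R / N%:R, +oo[%classic.
have mA l : measurable (A l) by apply: mf => //; exact: measurable_itv.
exists (fun x => \sum_(l < N) N%:R^-1 * \1_(A l) x); split.
- by apply: measurable_sum => l; apply: measurable_funM => //; exact: measurable_indic.
- exact: step_approx_sum.
apply: (@le_trans _ _ (N%:R^-1%:E * m (unitI R))%E); last first.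
  by rewrite -[m _](fineK mI) -EFinM lee_fin.
apply: L1dist_le_cst => //.
  by apply: measurable_sum => l; apply: measurable_funM => //; exact: measurable_indic.
move=> x Ix; have /andP[f0 f1] := f01 _ Ix.
have Nf0 : 0 <= N%:R * f x by rewrite mulr_ge0 // ltW.
set t := Num.truncn (N%:R * f x).
have tN : (t <= N)%N.
  rewrite -ltnS truncn_lt_nat // (@le_lt_trans _ _ N%:R) ?ltr_nat //.
  by rewrite ler_piMr // ltW.
have -> : \sum_(l < N) N%:R^-1 * \1_(A l) x = N%:R^-1 * t%:R :> R.
  rewrite -mulr_sumr; congr (_ * _).
  rewrite -[t in RHS]card_ord -sum1_card natr_sum (big_ord_widen N (fun=> 1)) //.
  rewrite [RHS]big_mkcond; apply: eq_bigr => l _; rewrite indicE truncn_gt_nat.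
  have -> : (x \in A l) = (l.+1%:R <= N%:R * f x).
    rewrite /A in_setI mem_set //= [N%:R * _]mulrC -ler_pdivrMr //.
    by apply/idP/idP; rewrite inE /= in_itv /= andbT.
  by case: ifP.
have /andP[t1 t2] := truncn_itv Nf0.
have -> : f x - N%:R^-1 * t%:R = N%:R^-1 * (N%:R * f x - t%:R).
  by rewrite mulrBr mulKf // lt0r_neq0.
rewrite normrM gtr0_norm ?invr_gt0 // ler_piMr ?invr_ge0 ?ler0n //.
by rewrite ger0_norm ?subr_ge0 // lerBlDl natr1 ltW.
Qed.

End density.

(** * Rounding to a fractional partition *)

(** Wrong row sums are corrected by mixing g with a small multiple of a
    column-independent matrix. *)
Lemma Kmx_repair (R : realType) (k n : nat) (g : 'M[R]_(k, n)) (d : R) :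
  (0 < k)%N -> (0 < n)%N -> 0 < d -> k%:R * d <= 1 ->
  (forall i a, 0 <= g i a) -> (forall a, \sum_i g i a = 1) ->
  (forall i, `|(\sum_a g i a) / n%:R - k%:R^-1| <= d) ->
  exists2 M, Kmx M & forall i a, `|M i a - g i a| <= k%:R * d.
Proof.
move=> k0 n0 d0 kd1 g0 g1 gr; set th := k%:R * d.
have kR : 0 < k%:R :> R by rewrite ltr0n.
have nR : 0 < n%:R :> R by rewrite ltr0n.
have th0 : 0 < th by rewrite mulr_gt0.
pose c i := (\sum_a g i a) / n%:R.
have c1 : \sum_i c i = 1.
  rewrite -mulr_suml exchange_big /=; under eq_bigr do rewrite g1.
  by rewrite sumr_const card_ord divff // lt0r_neq0.
have c0 i : 0 <= c i by rewrite divr_ge0 ?sumr_ge0 // ltW.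
(* u is determined by requiring that (1 - th) c + th u be constantly 1 / k.  It is
   nonnegative for th = k d because c exceeds 1 / k by at most d. *)
pose u i := c i + (k%:R^-1 - c i) / th.
have u0 i : 0 <= u i.
  have -> : u i = (th * c i + (k%:R^-1 - c i)) / th.
    by rewrite /u; field; rewrite !lt0r_neq0.
  rewrite divr_ge0 ?(ltW th0) //.
  have [ck|kc] := leP (c i) k%:R^-1.
    by rewrite addr_ge0 ?subr_ge0 // mulr_ge0 // ltW.
  have : d <= th * c i.
    have -> : d = th * k%:R^-1 by rewrite /th; field; rewrite lt0r_neq0.
    by rewrite ler_pM2l // ltW.
  have := gr i; rewrite -/(c i) ler_distl => /andP[_]; lra.
have u1 : \sum_i u i = 1.
  rewrite big_split /= c1 -mulr_suml sumrB c1 sumr_const card_ord.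
  by rewrite -(mulr_natl k%:R^-1) divff ?lt0r_neq0 // subrr mul0r addr0.
have ule1 i : u i <= 1.
  by rewrite -u1 (bigD1 i) //= lerDl sumr_ge0.
have gle1 i a : g i a <= 1.
  by rewrite -(g1 a) (bigD1 i) //= lerDl sumr_ge0.
exists (\matrix_(i, a) ((1 - th) * g i a + th * u i)).
  split.
  - move=> i a; rewrite mxE addr_ge0 ?mulr_ge0 ?subr_ge0 //; exact: ltW.
  - move=> i; under eq_bigr do rewrite mxE.
    rewrite big_split /= -mulr_sumr sumr_const card_ord -[_ *+ n]mulr_natl.
    have -> : \sum_a g i a = n%:R * c i by rewrite /c mulrC divfK // lt0r_neq0.
    by rewrite /u; field; rewrite !lt0r_neq0.
  - move=> a; under eq_bigr do rewrite mxE.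
    by rewrite big_split /= -!mulr_sumr g1 u1; ring.
move=> i a; rewrite mxE.
have -> : (1 - th) * g i a + th * u i - g i a = th * (u i - g i a) by ring.
rewrite normrM (gtr0_norm th0) ler_piMr ?(ltW th0) //.
have := u0 i; have := ule1 i; have := g0 i a; have := gle1 i a.
by rewrite ler_norml; lra.
Qed.

(** When no entry is positive the family is replaced by the uniform one, so that
    the entries always add up to 1. *)
Definition normalize (R : realFieldType) (k : nat) (h : 'I_k -> R) (i : 'I_k)
    : R :=
  let s := \sum_j Num.max (h j) 0 in
  if s == 0 then k%:R^-1 else Num.max (h i) 0 / s.

Section normalize.
Context (R : realFieldType) (k : nat) (k0 : (0 < k)%N).
Implicit Types h F : 'I_k -> R.

Lemma normalize_ge0 h i : 0 <= normalize h i.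
Proof.
rewrite /normalize; case: ifP => _; rewrite ?invr_ge0 ?ler0n //.
by rewrite divr_ge0 ?sumr_ge0 // => [|j _]; rewrite le_max lexx orbT.
Qed.

Lemma sum_normalize h : \sum_i normalize h i = 1.
Proof.
rewrite /normalize; have [s0|s0] := eqVneq (\sum_j Num.max (h j) 0) 0.
  by rewrite sumr_const card_ord -[LHS]mulr_natl divff // pnatr_eq0 -lt0n.
by rewrite -mulr_suml divff.
Qed.

(** Truncation at 0 moves h closer to F, and the division moves the entries by
    at most the distance of their sum from 1, which is also the sum of F. *)
Lemma normalize_close h F i : (forall j, 0 <= F j) -> \sum_j F j = 1 ->
  `|F i - normalize h i| <= 2 * \sum_j `|F j - h j|.
Proof.
move=> F0 F1; set E := \sum_j `|F j - h j|.
pose p j := Num.max (h j) 0.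
have p0 j : 0 <= p j by rewrite /p le_max lexx orbT.
have Fp j : `|F j - p j| <= `|F j - h j|.
  rewrite /p; case: (leP 0 (h j)) => [//|hj].
  rewrite subr0 !ger0_norm //; last by rewrite subr_ge0 (le_trans (ltW hj)).
  by rewrite lerBrDl gerDr ltW.
have FpE : `|F i - p i| <= E.
  by apply: (le_trans (Fp i)); rewrite /E (bigD1 i) //= lerDl sumr_ge0.
have sE : `|1 - \sum_j p j| <= E.
  rewrite -F1 -sumrB; apply: le_trans (ler_norm_sum _ _ _) _.
  exact: ler_sum.
suff pn : `|p i - normalize h i| <= `|1 - \sum_j p j|.
  have -> : F i - normalize h i = (F i - p i) + (p i - normalize h i) by ring.
  by apply: le_trans (ler_normD _ _) _; rewrite mulr_natl mulr2n lerD // (le_trans pn).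
have pis : p i <= \sum_j p j by rewrite (bigD1 i) //= lerDl sumr_ge0.
rewrite /normalize -/(p i) -[\sum_j Num.max (h j) 0]/(\sum_j p j).
move: pis; set s := \sum_j p j => pis.
have [s0|s0] := eqVneq s 0.
  have -> : p i = 0 by apply/le_anti; rewrite p0 andbT -s0.
  rewrite sub0r normrN s0 subr0 normr1 ger0_norm ?invr_ge0 ?ler0n //.
  by rewrite invf_le1 ?ler1n ?ltr0n.
have sp : 0 < s by rewrite lt_neqAle eq_sym s0 (le_trans (p0 i)).
have -> : p i - p i / s = (p i / s) * (s - 1) by field.
rewrite normrM distrC ler_piMl // ger0_norm ?divr_ge0 ?(ltW sp) //.
by rewrite ler_pdivrMr // mul1r.
Qed.

End normalize.

Section integrals.
Local Open Scope ereal_scope.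
Context d (T : measurableType d) (R : realType).
Context (mu : {measure set T -> \bar R}) (D : set T) (mD : measurable D).

Lemma integral_close (F G : T -> R) (a b e : R) :
  measurable_fun D F -> measurable_fun D G ->
  (forall x, D x -> 0 <= F x)%R -> (forall x, D x -> 0 <= G x)%R ->
  \int[mu]_(x in D) (F x)%:E = a%:E -> \int[mu]_(x in D) (G x)%:E = b%:E ->
  \int[mu]_(x in D) `|F x - G x|%:E <= e%:E ->
  (`|a - b| <= e)%R.
Proof.
move=> mF mG F0 G0 ia ib ie.
have half (P Q : T -> R) (p q : R) : measurable_fun D P -> measurable_fun D Q ->
    (forall x, D x -> 0 <= P x)%R -> (forall x, D x -> 0 <= Q x)%R ->
    \int[mu]_(x in D) (P x)%:E = p%:E -> \int[mu]_(x in D) (Q x)%:E = q%:E ->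
    \int[mu]_(x in D) `|P x - Q x|%:E <= e%:E -> (p <= q + e)%R.
  move=> mP mQ P0 Q0 ip iq ipq; rewrite -lee_fin EFinD -ip -iq.
  apply: le_trans (leeD2l _ ipq); rewrite -ge0_integralD //.
  - apply: ge0_le_integral => //; first exact/measurable_EFinP.
    + apply: emeasurable_funD; first exact/measurable_EFinP.
      exact: measurable_EFin_norm_sub.
    + move=> x Dx; rewrite -EFinD lee_fin -lerBlDl ler_norm //.
  - exact/measurable_EFinP.
  - exact: measurable_EFin_norm_sub.
have h1 := half _ _ _ _ mF mG F0 G0 ia ib ie.
have h2 : (b <= a + e)%R.
  apply: (half _ _ _ _ mG mF G0 F0 ib ia).
  by under eq_integral do rewrite distrC.
by rewrite ler_distl; apply/andP; split => //; rewrite lerBlDr.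
Qed.

End integrals.

(** * Energies of step functions *)

Lemma integral_step (R : realType) (n : nat) (c : 'I_n.+1 -> R) :
  (forall a, 0 <= c a) ->
  (\int[lebesgue_measure]_(x in unitI R) (step c x)%:E
     = ((\sum_a c a) / n.+1%:R)%:E)%E.
Proof.
move=> c0; rewrite /step; under eq_integral do rewrite -sumEFin.
rewrite ge0_integral_sum //; last 2 first.
- move=> a; apply/measurable_EFinP/measurable_funM => //.
  exact: measurable_indic (measurable_cell a).
- by move=> a x _; rewrite lee_fin mulr_ge0 // indicE.
rewrite mulr_suml -sumEFin; apply: eq_bigr => a _.
under eq_integral do rewrite EFinM.
rewrite ge0_integralZl_EFin //; last first.
  by apply/measurable_EFinP; apply: measurable_indic; exact: measurable_cell.
rewrite integral_indic //; last exact: measurable_cell.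
rewrite setIidl; last exact: cell_unitI.
by rewrite EFinM; congr (_ * _)%E; exact: lebesgue_measure_cell.
Qed.

Lemma frac_partition_le1 (R : realType) (k : nat)
    (f : 'I_k -> measurableTypeR R -> R) i x :
  frac_partition f -> unitI R x -> 0 <= f i x <= 1.
Proof.
move=> [_ f0 f1 _] Ix; rewrite f0 //= -(f1 _ Ix) (bigD1 i) //= lerDl.
by apply: sumr_ge0 => j _; exact: f0.
Qed.

Section partition.
Context {R : realType} (m : {measure set (measurableTypeR R) -> \bar R}).
Context (mfin : (m (unitI R) < +oo)%E).
Context (lebesgue_le : forall h : measurableTypeR R -> R,
  measurable_fun (unitI R) h -> (forall x, unitI R x -> 0 <= h x) ->
  (\int[lebesgue_measure]_(x in unitI R) (h x)%:E
     <= \int[m]_(x in unitI R) (h x)%:E)%E).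

Lemma L1dist_le_sum (I : finType) (r : R) (F H : I -> measurableTypeR R -> R)
    (h h' : measurableTypeR R -> R) : 0 <= r ->
  (forall i, measurable_fun (unitI R) (F i)) ->
  (forall i, measurable_fun (unitI R) (H i)) ->
  measurable_fun (unitI R) h -> measurable_fun (unitI R) h' ->
  (forall x, unitI R x -> `|h x - h' x| <= r * \sum_i `|F i x - H i x|) ->
  (L1dist m h h' <= r%:E * \sum_i L1dist m (F i) (H i))%E.
Proof.
move=> r0 mF mH mh mh' le; rewrite /L1dist -ge0_integral_sum //; last first.
  by move=> i; exact: measurable_EFin_norm_sub.
have mS : measurable_fun (unitI R) (fun x => \sum_i `|F i x - H i x|%:E)%E.
  by apply: emeasurable_sum => i; exact: measurable_EFin_norm_sub.
rewrite -ge0_integralZl_EFin //; last by move=> x _; apply: sume_ge0.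
apply: ge0_le_integral => //; first exact: measurable_EFin_norm_sub.
- by apply: emeasurable_funM.
- by move=> x Ix; rewrite sumEFin -EFinM lee_fin le.
Qed.

(** Approximate every part by a step function, normalize on each cell to restore
    the sum 1, and correct the integrals by [Kmx_repair]; as Lebesgue measure is
    dominated by m, these integrals are already close to 1 / k. *)
Lemma partition_step_approx (k : nat) (f : 'I_k -> measurableTypeR R -> R)
    (e : R) : (0 < k)%N -> frac_partition f -> 0 < e ->
  \forall n \near \oo, exists2 M : 'M[R]_(k, n.+1), Kmx M &
    forall i, (L1dist m (f i) (step (M i)) <= e%:E)%E.
Proof.
move=> k0 fp e0; have [mf f0 f1 fk] := fp.
have mI : m (unitI R) \is a fin_num by rewrite ge0_fin_numE.
pose C := fine (m (unitI R)); have C0 : 0 <= C by rewrite fine_ge0.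
have kR : 0 < k%:R :> R by rewrite ltr0n.
(* Normalized step functions will be within dl of f, and their repair moves them
   by k dl at each point of a space of mass C; the last summand of B ensures
   k dl <= 1. *)
pose B := 1 + k%:R * C + k%:R.
have B0 : 0 < B by rewrite /B; have := mulr_ge0 (ltW kR) C0; lra.
pose dl := Num.min 1 e / B.
have me0 : 0 < Num.min 1 e by rewrite lt_min ltr01.
have dl0 : 0 < dl by rewrite divr_gt0.
have dlB : dl * B = Num.min 1 e by rewrite divfK // lt0r_neq0.
have kdl : k%:R * dl <= 1.
  apply: (@le_trans _ _ (Num.min 1 e)); last by rewrite ge_min lexx.
  rewrite -dlB mulrC ler_wpM2l ?(ltW dl0) // /B.
  have := mulr_ge0 (ltW kR) C0; lra.
have dle : dl + k%:R * dl * C <= e.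
  apply: (@le_trans _ _ (Num.min 1 e)); last by rewrite ge_min lexx orbT.
  rewrite -dlB (_ : _ + _ = dl * (1 + k%:R * C)); last by ring.
  by rewrite ler_wpM2l ?(ltW dl0) // /B lerDl ltW.
(* Normalization multiplies the error by 2 and sums it over the k parts. *)
pose d := dl / (2 * k%:R).
have d0 : 0 < d by rewrite divr_gt0 // mulr_gt0.
have : \forall n \near \oo, forall i, exists c : 'I_n.+1 -> R,
    (L1dist m (f i) (step c) <= d%:E)%E.
  apply: filter_forall => i; apply: (step_approx_unit mfin) => //.
  by move=> x; exact: frac_partition_le1.
apply: (@filterS _ \oo) => n hn; have [h hd] := choice hn.
pose g : 'M[R]_(k, n.+1) := \matrix_(i, a) normalize (h^~ a) i.
have g0 i a : 0 <= g i a by rewrite mxE normalize_ge0.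
have g1 a : \sum_i g i a = 1.
  by under eq_bigr do rewrite mxE; exact: sum_normalize.
have gle1 i a : g i a <= 1 by rewrite -(g1 a) (bigD1 i) //= lerDl sumr_ge0.
have fg i : (L1dist m (f i) (step (g i)) <= dl%:E)%E.
  apply: (@le_trans _ _ (2%:E * \sum_j L1dist m (f j) (step (h j)))%E).
    apply: L1dist_le_sum => //; try by move=> *; exact: measurable_step.
    move=> x Ix; have [a ax] := @cell_cover _ n _ Ix.
    under eq_bigr do rewrite (stepE _ ax).
    rewrite (stepE _ ax) mxE; apply: normalize_close => //; last exact: f1.
    by move=> j; exact: f0.
  apply: (@le_trans _ _ (2%:E * \sum_(j < k) d%:E)%E).
    by rewrite lee_pmul2l // lee_sum.
  rewrite sumEFin -EFinM sumr_const card_ord -(mulr_natl d) lee_fin /d.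
  by rewrite le_eqVlt; apply/orP; left; apply/eqP; field; rewrite lt0r_neq0.
have gk i : `|(\sum_a g i a) / n.+1%:R - k%:R^-1| <= dl.
  rewrite distrC.
  apply: (@integral_close _ _ _ lebesgue_measure (unitI R) _ (f i) (step (g i))) => //.
  - exact: measurable_step.
  - by move=> x Ix; exact: f0.
  - by move=> x Ix; have [a ax] := @cell_cover _ n _ Ix; rewrite (stepE _ ax).
  - exact: integral_step.
  - apply: le_trans (fg i); apply: lebesgue_le => //.
    apply: measurableT_comp => //; apply: measurable_funB => //.
    exact: measurable_step.
have [M KM Mg] := Kmx_repair k0 (ltn0Sn n) dl0 kdl g0 g1 gk.
exists M => // i.
apply: (@le_trans _ _ (dl%:E + (k%:R * dl)%:E * m (unitI R))%E); last first.
  by rewrite -[m _](fineK mI) -EFinM -EFinD lee_fin.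
have gM : (L1dist m (step (g i)) (step (M i)) <= (k%:R * dl)%:E * m (unitI R))%E.
  apply: L1dist_le_cst => //; try exact: measurable_step.
    by rewrite mulr_ge0 // ltW.
  move=> x Ix; have [a ax] := @cell_cover _ n _ Ix.
  by rewrite !(stepE _ ax) distrC.
apply: le_trans (leeD (fg i) gM).
apply: L1dist_le_add => //; try exact: measurable_step.
by move=> x _; apply: le_trans (ler_normD _ _); rewrite addrA subrK.
Qed.

End partition.

Lemma measurable_unitsq (R : realType) : measurable (unitsq R).
Proof. exact: measurableX. Qed.
#[global] Hint Resolve measurable_unitsq : core.

Section plane.
Context {R : realType}.
Context (mu : probability (measurableTypeR R * measurableTypeR R)%type R).

Lemma image_measure_le
    (phi : measurableTypeR R * measurableTypeR R -> measurableTypeR R) :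
  measurable_fun setT phi -> (forall z, unitsq R z -> unitI R (phi z)) ->
  exists2 m : {measure set (measurableTypeR R) -> \bar R},
  (m (unitI R) < +oo)%E &
  forall h : measurableTypeR R -> R,
    measurable_fun (unitI R) h -> (forall x, unitI R x -> 0 <= h x) ->
   (\int[mu]_(z in unitsq R) (h (phi z))%:E
      <= \int[m]_(x in unitI R) (h x)%:E)%E.
Proof.
move=> mphi phiI.
pose m : {measure set (measurableTypeR R) -> \bar R} :=
  Measure.clone _ _ _ (pushforward mu phi)
    (@measure_function_pushforward__canonical__measure_function_Measure
       _ _ _ _ _ mu phi mphi).
have mpre : measurable (phi @^-1` unitI R).
  by rewrite -[X in measurable X]setTI; exact: (mphi).
exists m.
  rewrite /m /= /pushforward; apply: (@le_lt_trans _ _ 1%E); last exact: ltry.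
  exact: probability_le1.
move=> h mh h0; rewrite (ge0_integral_pushforward mphi) //; last first.
- by move=> x /set_mem Ix; rewrite lee_fin h0.
- exact/measurable_EFinP.
apply: ge0_subset_integral => //.
apply/measurable_EFinP; apply: (measurable_comp _ _ mh) => //.
  by move=> _ [z ? <-].
exact: measurable_funTS.
by move=> z Iz; rewrite lee_fin h0.
Qed.

(** The measure m dominates Lebesgue measure and both marginals of mu. *)
Definition controls (m : {measure set (measurableTypeR R) -> \bar R}) :=
  forall h : measurableTypeR R -> R,
    measurable_fun (unitI R) h -> (forall x, unitI R x -> 0 <= h x) ->
  [/\ (\int[lebesgue_measure]_(x in unitI R) (h x)%:E
         <= \int[m]_(x in unitI R) (h x)%:E)%E,
      (\int[mu]_(z in unitsq R) (h z.1)%:E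
         <= \int[m]_(x in unitI R) (h x)%:E)%E &
      (\int[mu]_(z in unitsq R) (h z.2)%:E
         <= \int[m]_(x in unitI R) (h x)%:E)%E].

(** The sum of the three measures. *)
Lemma control_measure :
  exists2 m : {measure set (measurableTypeR R) -> \bar R},
  (m (unitI R) < +oo)%E &
  controls m.
Proof.
have [//|m1 fin1 le1] := image_measure_le measurable_fst; first by move=> z [].
have [//|m2 fin2 le2] := image_measure_le measurable_snd; first by move=> z [].
pose m12 : {measure set (measurableTypeR R) -> \bar R} := measure_add m1 m2.
pose m : {measure set (measurableTypeR R) -> \bar R} :=
  measure_add lebesgue_measure m12.
exists m.
  rewrite -[m _]/(measure_add lebesgue_measure m12 (unitI R)) measure_addE.
  rewrite -[m12 _]/(measure_add m1 m2 (unitI R)) measure_addE.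
  apply: lte_add_pinfty; last exact: lte_add_pinfty.
  have : (lebesgue_measure (unitI R) < +oo)%E.
    by rewrite /unitI lebesgue_measure_itv /= lte_fin ltr01 -EFinB ltry.
  exact.
move=> h mh h0; have h0E x : unitI R x -> (0 <= (h x)%:E)%E.
  by move=> Ix; rewrite lee_fin h0.
have mhE : measurable_fun (unitI R) (fun x => (h x)%:E) by exact/measurable_EFinP.
have -> : (\int[m]_(x in unitI R) (h x)%:E
    = \int[lebesgue_measure]_(x in unitI R) (h x)%:E
     + (\int[m1]_(x in unitI R) (h x)%:E + \int[m2]_(x in unitI R) (h x)%:E))%E.
  by rewrite /m ge0_integral_measure_add // ge0_integral_measure_add.
have i0 (m' : {measure set (measurableTypeR R) -> \bar R}) :
    (0 <= \int[m']_(x in unitI R) (h x)%:E)%E by exact: integral_ge0.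
split.
- by apply: leeDl; rewrite adde_ge0.
- apply: le_trans (le1 h mh h0) _; rewrite addeCA; apply: leeDl.
  by rewrite adde_ge0.
- apply: le_trans (le2 h mh h0) _; rewrite addeA addeC; apply: leeDl.
  by rewrite adde_ge0.
Qed.

Definition cell_mass (n : nat) : 'M[R]_n.+1 :=
  \matrix_(a, b) fine (mu (cell a `*` cell b)).

Lemma measurable_cellX n (a b : 'I_n.+1) :
  measurable (cell a `*` cell b : set (measurableTypeR R * measurableTypeR R)).
Proof. by apply: measurableX; exact: measurable_cell. Qed.

Lemma cell_massE n (a b : 'I_n.+1) :
  (cell_mass n a b)%:E = mu (cell a `*` cell b).
Proof.
by rewrite mxE fineK //; apply: fin_num_measure; exact: measurable_cellX.
Qed.

Lemma plane_energy_step n (c d : 'I_n.+1 -> R) :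
  (forall a, 0 <= c a) -> (forall a, 0 <= d a) ->
  (\int[mu]_(z in unitsq R) (step c z.1 * step d z.2)%:E
     = (\sum_a \sum_b c a * cell_mass n a b * d b)%:E)%E.
Proof.
move=> c0 d0.
have E z : (step c z.1 * step d z.2)%:E = (\sum_(p : 'I_n.+1 * 'I_n.+1)
   (c p.1 * d p.2)%:E * (\1_(cell p.1 `*` cell p.2) z)%:E)%E.
  rewrite /step mulr_suml -sumEFin sum_pair; apply: eq_bigr => a _.
  rewrite mulr_sumr -sumEFin; apply: eq_bigr => b _ /=.
  by rewrite -EFinM; congr (_%:E); rewrite !indicE in_setX -mulnb natrM; ring.
under eq_integral do rewrite E.
rewrite ge0_integral_sum //; last 2 first.
- move=> p; apply: emeasurable_funM => //.
  by apply/measurable_EFinP; apply: measurable_indic; exact: measurable_cellX.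
- by move=> p z _; rewrite -EFinM lee_fin !mulr_ge0 // indicE.
rewrite sum_pair -sumEFin; apply: eq_bigr => a _.
rewrite -sumEFin; apply: eq_bigr => b _ /=.
rewrite ge0_integralZl_EFin ?mulr_ge0 //; first last.
- by apply/measurable_EFinP; apply: measurable_indic; exact: measurable_cellX.
- exact: measurable_unitsq.
rewrite integral_indic; [|exact: measurable_unitsq|exact: measurable_cellX].
rewrite setIidl; last first.
  by move=> z [za zb]; split; [exact: cell_unitI za|exact: cell_unitI zb].
transitivity ((c a * d b)%:E * (cell_mass n a b)%:E)%E; first by rewrite cell_massE.
by rewrite -EFinM; congr (_%:E); ring.
Qed.

Lemma measurable_plane_prod (f g : measurableTypeR R -> R) :
  measurable_fun (unitI R) f -> measurable_fun (unitI R) g ->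
  measurable_fun (unitsq R) (fun z => f z.1 * g z.2).
Proof.
move=> mf mg; apply: measurable_funM.
  apply: (measurable_comp _ _ mf) => //; first by move=> _ [z [? ?] <-].
  exact: measurable_funTS measurable_fst.
apply: (measurable_comp _ _ mg) => //; first by move=> _ [z [? ?] <-].
exact: measurable_funTS measurable_snd.
Qed.

(** For functions with values in [0, 1] the difference of two products is at most
    the sum of the differences of the factors, and each of these depends on one
    variable only, so that a marginal of mu suffices to integrate it. *)
Lemma plane_energy_close (m : {measure set (measurableTypeR R) -> \bar R})
    n (f g : measurableTypeR R -> R) (c d : 'I_n.+1 -> R) (e x : R) :
  controls m ->
  measurable_fun (unitI R) f -> measurable_fun (unitI R) g ->
  (forall x, unitI R x -> 0 <= f x <= 1) ->
  (forall x, unitI R x -> 0 <= g x <= 1) ->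
  (forall a, 0 <= c a <= 1) -> (forall a, 0 <= d a <= 1) ->
  (L1dist m f (step c) <= e%:E)%E -> (L1dist m g (step d) <= e%:E)%E ->
  (\int[mu]_(z in unitsq R) (f z.1 * g z.2)%:E = x%:E)%E ->
  `|x - \sum_a \sum_b c a * cell_mass n a b * d b| <= 2 * e.
Proof.
move=> ctl mf mg f01 g01 c01 d01 fc gd ix.
have s01 (c' : 'I_n.+1 -> R) y : (forall a, 0 <= c' a <= 1) -> unitI R y ->
    0 <= step c' y <= 1.
  by move=> c'01 Iy; have [a ay] := @cell_cover _ n _ Iy; rewrite (stepE _ ay).
have c0 a : 0 <= c a by case/andP: (c01 a).
have d0 a : 0 <= d a by case/andP: (d01 a).
have mc := @measurable_step _ n c (unitI R).
have md := @measurable_step _ n d (unitI R).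
refine (@integral_close _ _ _ mu (unitsq R) (@measurable_unitsq R)
  (fun z => f z.1 * g z.2) (fun z => step c z.1 * step d z.2) _ _ _
  _ _ _ _ ix (plane_energy_step c0 d0) _).
- exact: measurable_plane_prod.
- exact: measurable_plane_prod.
- by move=> z [/f01/andP[? _] /g01/andP[? _]]; exact: mulr_ge0.
- move=> z [z1 z2]; have /andP[? _] := s01 _ _ c01 z1.
  by have /andP[? _] := s01 _ _ d01 z2; exact: mulr_ge0.
have mdf : measurable_fun (unitI R) (fun y => `|f y - step c y|).
  by apply: measurableT_comp => //; exact: measurable_funB.
have mdg : measurable_fun (unitI R) (fun y => `|g y - step d y|).
  by apply: measurableT_comp => //; exact: measurable_funB.
have [_ h1 _] := ctl _ mdf (fun y _ => normr_ge0 _).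
have [_ _ h2] := ctl _ mdg (fun y _ => normr_ge0 _).
have -> : 2 * e = e + e by ring.
rewrite EFinD; apply: le_trans (leeD (le_trans h1 fc) (le_trans h2 gd)).
have m1 : measurable_fun (unitsq R) (fun z => `|f z.1 - step c z.1|%:E).
  apply/measurable_EFinP; apply: (measurable_comp _ _ mdf) => //.
    by move=> _ [z [? ?] <-].
  exact: measurable_funTS measurable_fst.
have m2 : measurable_fun (unitsq R) (fun z => `|g z.2 - step d z.2|%:E).
  apply/measurable_EFinP; apply: (measurable_comp _ _ mdg) => //.
    by move=> _ [z [? ?] <-].
  exact: measurable_funTS measurable_snd.
rewrite -ge0_integralD //; apply: ge0_le_integral => //.
- by apply: measurable_EFin_norm_sub; exact: measurable_plane_prod.
- exact: emeasurable_funD.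
- move=> z [z1 z2]; rewrite -EFinD lee_fin.
  have -> : f z.1 * g z.2 - step c z.1 * step d z.2 =
     (f z.1 - step c z.1) * g z.2 + step c z.1 * (g z.2 - step d z.2) by ring.
  apply: le_trans (ler_normD _ _) _; rewrite !normrM.
  have /andP[? ?] := g01 _ z2; have /andP[? ?] := s01 _ _ c01 z1.
  by apply: lerD; [rewrite ler_piMr // ger0_norm|rewrite ler_piMl // ger0_norm].
Qed.

End plane.

(** * Compactness and the Hausdorff distance *)

Section matrix_topology.
Context {R : realType}.

Lemma entrywise_continuous (T : topologicalType) (m n : nat)
    (f : T -> 'M[R]_(m, n)) :
  (forall i j, continuous (fun x => f x i j)) -> continuous f.
Proof.
move=> cf x B [P xP PB]; suff : \forall x' \near x, forall i j, P i j (f x' i j).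
  by apply: filterS => x' Px'; exact: PB.
apply: filter_forall => i; apply: filter_forall => j.
exact: cf (xP i j).
Qed.

Lemma sum_continuous (T : topologicalType) (I : finType) (f : I -> T -> R) :
  (forall i, continuous (f i)) -> continuous (fun x => \sum_i f i x).
Proof.
move=> cf; rewrite (_ : (fun _ => _) = \sum_i f i); last first.
  by apply/funext => x; rewrite fct_sumE.
elim/big_ind : _ => [x|g h cg ch x|//]; first exact: cvg_cst.
exact: continuousD (cg x) (ch x).
Qed.

Lemma unit_box_compact (m n : nat) :
  compact [set A : 'M[R]_(m, n) | forall i j, 0 <= A i j <= 1].
Proof.
pose box := [set v : 'rV[R]_(m * n) | forall j, `[0, 1]%classic (v ord0 j)].
rewrite (_ : [set A | _] = vec_mx @` box).
  apply: continuous_compact; last exact: (rV_compact (fun _ => @segment_compact R 0 1)).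
  apply: continuous_subspaceT; apply: entrywise_continuous => i j.
  rewrite (_ : (fun x => _) =
      (fun v : 'rV[R]_(m * n) => v ord0 (mxvec_index i j))).
    exact: coord_continuous.
  by apply/funext => v; rewrite mxE.
apply/seteqP; split => [A A01|_ [v v01 <-] i j]; last first.
  by rewrite mxE; have := v01 (mxvec_index i j); rewrite /= in_itv.
exists (mxvec A); last exact: mxvecK.
by move=> j; case/mxvec_indexP: j => i j; rewrite mxvecE /= in_itv /=.
Qed.

Lemma closed_entry m n (i : 'I_m) (j : 'I_n) (D : set R) : closed D ->
  closed [set M : 'M[R]_(m, n) | D (M i j)].
Proof.
apply: (@preimage_closed _ _ (fun M : 'M[R]_(m, n) => M i j) D) => M _.
exact: coord_continuous.
Qed.

Lemma unit_box_closed (m n : nat) :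
  closed [set A : 'M[R]_(m, n) | forall i j, 0 <= A i j <= 1].
Proof.
rewrite (_ : [set A | _] =
    \bigcap_i \bigcap_j [set A : 'M[R]_(m, n) | `[0, 1]%classic (A i j)]).
  apply: closed_bigI => i _; apply: closed_bigI => j _; apply: (@closed_entry _ _ i j).
  exact: compact_closed (@Rhausdorff R) (@segment_compact R 0 1).
apply/seteqP; split => [A A01 i _ j _|A A01 i j]; first by rewrite /= in_itv /=.
by have := A01 i I j I; rewrite /= in_itv.
Qed.

Lemma Kmx_compact (k n : nat) : compact (@Kmx R k n).
Proof.
apply: (subclosed_compact _ (@unit_box_compact k n)); last first.
  by move=> M KM i j; exact: Kmx_le1.
rewrite (_ : @Kmx R k n = (\bigcap_i \bigcap_j [set M | 0 <= M i j])
   `&` (\bigcap_i [set M | \sum_(j < n) M i j = n%:R / k%:R])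
   `&` (\bigcap_j [set M | \sum_(i < k) M i j = 1])).
  apply: closedI; first apply: closedI.
  - apply: closed_bigI => i _; apply: closed_bigI => j _; 
    exact: closed_entry (@closed_ge R 0).
  - apply: closed_bigI => i _.
    apply: (@preimage_closed _ _ (fun M : 'M[R]_(k, n) => \sum_(j < n) M i j)
      [set x | x = n%:R / k%:R]) => [M _|]; last exact: closed_eq.
    by apply: sum_continuous => j; exact: coord_continuous.
  - apply: closed_bigI => j _.
    apply: (@preimage_closed _ _ (fun M : 'M[R]_(k, n) => \sum_(i < k) M i j)
      [set x | x = 1]) => [M _|]; last exact: closed_eq.
    by apply: sum_continuous => i; exact: coord_continuous.
apply/seteqP; split => [M [M0 Mr Mc]|M [[M0 Mr] Mc]].
  by split => [|j _]; [split => [i _ j _|i _]; [exact: M0|exact: Mr]|exact: Mc].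
by split => [i j|i|j]; [exact: (M0 i I j I)|exact: (Mr i I)|exact: (Mc j I)].
Qed.

Lemma Cmx_compact (n : nat) (S : 'M[R]_n) (k : nat) : compact (Cmx S k).
Proof.
apply: continuous_compact; last exact: Kmx_compact.
apply: continuous_subspaceT; apply: entrywise_continuous => i j.
rewrite (_ : (fun _ => _) = fun M : 'M[R]_(k, n) =>
    \sum_a \sum_b M i a * S a b * M j b); last first.
  by apply/funext => M; rewrite mulmx_energy.
apply: sum_continuous => a; apply: sum_continuous => b M.
have cM c d : {for M, continuous (fun M : 'M[R]_(k, n) => M c d)}.
  exact: coord_continuous.
exact: (continuousM (continuousM (cM i a) (@cst_continuous _ R (S a b) M)) (cM j b)).
Qed.

Lemma C0_compact (G : sgraph) (k : nat) : compact (C0 R G k).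
Proof.
apply: continuous_compact; last exact: Cmx_compact.
apply: continuous_subspaceT; apply: entrywise_continuous => i j.
rewrite (_ : (fun _ => _) = fun M : 'M[R]_k => (mxl1 (adjmx R G))^-1 * M i j).
  move=> M; have cM : {for M, continuous (fun M : 'M[R]_k => M i j)}.
    exact: coord_continuous.
  exact: (continuousM (@cst_continuous _ R _ M) cM).
by apply/funext => M; rewrite mxE.
Qed.

Lemma Kmx_nonempty (k n : nat) : (0 < k)%N -> @Kmx R k n !=set0.
Proof.
move=> k0; exists (const_mx k%:R^-1); split => [i j|i|j].
- by rewrite mxE invr_ge0.
- by under eq_bigr do rewrite mxE; rewrite sumr_const card_ord -[LHS]mulr_natl.
- under eq_bigr do rewrite mxE; rewrite sumr_const card_ord -[LHS]mulr_natl.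
  by rewrite divff // pnatr_eq0 -lt0n.
Qed.

End matrix_topology.

Section hausdorff.
Context {R : realType} {k : nat}.
Implicit Types A B : set 'M[R]_k.

Lemma mxl1_entrywise (e : R) (a b : 'M[R]_k) : entrywise_close e a b ->
  mxl1 (a - b) <= k%:R ^+ 2 * e.
Proof.
move=> ab; apply: (@le_trans _ _ (\sum_(i < k) \sum_(j < k) e)).
  by apply: ler_sum => i _; apply: ler_sum => j _; rewrite !mxE.
by rewrite !sumr_const card_ord -mulrnA -[leLHS]mulr_natl natrM expr2.
Qed.

Lemma hausdorff_dist_le A B (e : R) :
  (forall a, A a -> exists2 b, B b & entrywise_close e a b) ->
  (forall b, B b -> exists2 a, A a & entrywise_close e a b) ->
  (hausdorff_dist A B <= (k%:R ^+ 2 * e)%:E)%E.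
Proof.
move=> AB BA; rewrite /hausdorff_dist ge_max; apply/andP; split.
- apply: ge_ereal_sup => _ [a Aa <-]; have [b Bb ab] := AB a Aa.
  apply: (@le_trans _ _ (mxl1 (a - b))%:E); last by rewrite lee_fin mxl1_entrywise.
  by apply: ereal_inf_lbound; exists b.
- apply: ge_ereal_sup => _ [b Bb <-]; have [a Aa ab] := BA b Bb.
  apply: (@le_trans _ _ (mxl1 (a - b))%:E); last by rewrite lee_fin mxl1_entrywise.
  by apply: ereal_inf_lbound; exists a.
Qed.

Lemma mxl1_ge0 m n (a : 'M[R]_(m, n)) : 0 <= mxl1 a.
Proof. by apply: sumr_ge0 => i _; apply: sumr_ge0. Qed.

Lemma hausdorff_dist_ge0 A B : A !=set0 -> (0 <= hausdorff_dist A B)%E.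
Proof.
move=> [a Aa]; rewrite /hausdorff_dist le_max; apply/orP; left.
apply: le_ereal_sup_tmp; eexists; first by exists a; [exact: Aa|reflexivity].
by apply: le_ereal_inf_tmp => _ [b _ <-]; rewrite lee_fin mxl1_ge0.
Qed.

(** Entrywise closeness costs only the factor k^2 in the l1 norm. *)
Lemma hausdorff_cvg_entrywise (F : nat -> set 'M[R]_k) (L : set 'M[R]_k) :
  (forall i, F i !=set0) -> (forall i, compact (F i)) ->
  L !=set0 -> compact L ->
  (forall e : R, 0 < e -> \forall i \near \oo,
     (forall a, F i a -> exists2 b, L b & entrywise_close e a b) /\
     (forall b, L b -> exists2 a, F i a & entrywise_close e a b)) ->
  hausdorff_cvg F L.
Proof.
move=> F0 Fc L0 Lc H; split => //.
have bnd (e : R) : 0 < e ->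
    \forall i \near \oo, (hausdorff_dist (F i) L <= e%:E)%E.
  move=> e0; pose K : R := k%:R ^+ 2 + 1.
  have K0 : 0 < K by rewrite ltr_wpDl ?exprn_ge0.
  have := H (e / K) (divr_gt0 e0 K0); apply: (@filterS _ \oo) => i [h1 h2].
  apply: le_trans (hausdorff_dist_le h1 h2) _; rewrite lee_fin.
  by rewrite mulrA ler_pdivrMr // mulrC ler_wpM2l ?(ltW e0) // lerDl.
apply/fine_cvgP; split.
  have := bnd 1 ltr01; apply: (@filterS _ \oo) => i h.
  rewrite ge0_fin_numE ?hausdorff_dist_ge0 //; exact: le_lt_trans h (ltry _).
apply/cvgrPdist_le => e e0; have := bnd e e0; apply: (@filterS _ \oo) => i h.
rewrite sub0r normrN; have h0 := @hausdorff_dist_ge0 (F i) L (F0 i).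
rewrite /= ger0_norm ?fine_ge0 // -lee_fin fineK //.
by rewrite ge0_fin_numE //; exact: le_lt_trans h (ltry _).
Qed.

End hausdorff.

(** * Graphs converging to an s-graphon *)

Section cmeas.
Context {R : realType}.
Context (mu : probability (measurableTypeR R * measurableTypeR R)%type R).

Lemma step_frac_partition (k n : nat) (M : 'M[R]_(k, n.+1)) : (0 < k)%N ->
  Kmx M -> frac_partition (fun i => step (M i)).
Proof.
move=> k0 [M0 Mr Mc]; split.
- by move=> i; exact: measurable_step.
- by move=> i x Ix; have [a ax] := @cell_cover _ n _ Ix; rewrite (stepE _ ax).
- move=> x Ix; have [a ax] := @cell_cover _ n _ Ix.
  by under eq_bigr do rewrite (stepE _ ax).
- move=> i; rewrite integral_step // Mr; congr (_%:E).
  by rewrite mulrAC divff ?mul1r // pnatr_eq0.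
Qed.

(** A row of M, spread over the cells, is a step function with the right integral;
    hence there is no error in this direction. *)
Lemma Cmx_cell_mass_sub (k n : nat) : (0 < k)%N ->
  Cmx (cell_mass mu n) k `<=` Cmeas mu k.
Proof.
move=> k0 _ [M KM <-]; apply: subset_closure.
exists (fun i => step (M i)); first exact: step_frac_partition.
have [M0 _ _] := KM.
by move=> i j; rewrite plane_energy_step // mulmx_energy.
Qed.

Lemma Cmeas_nonempty (k : nat) : (0 < k)%N -> Cmeas mu k !=set0.
Proof.
move=> k0; have [M KM] := @Kmx_nonempty R k 1 k0.
exists (M *m cell_mass mu 0 *m M^T).
by apply: (Cmx_cell_mass_sub k0); exists M.
Qed.

Lemma cell_mass_ge0 n a b : 0 <= cell_mass mu n a b.
Proof. by rewrite mxE fine_ge0. Qed.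

Lemma cell_mass_sym n a b : sgraphon mu ->
  cell_mass mu n a b = cell_mass mu n b a.
Proof.
move=> [_ sym]; rewrite !mxE -sym; last exact: measurable_cellX.
by congr (fine (mu _)); apply/seteqP; split => -[x y] [].
Qed.

Lemma sgraphon_unitsq : sgraphon mu -> mu (unitsq R) = 1%E.
Proof.
move=> [out _]; have := probability_setC mu (measurable_unitsq (R := R)).
rewrite out => /esym/eqP; rewrite sube_eq //.
by rewrite add0e => /eqP.
Qed.

Lemma sum_cell_mass n : sgraphon mu -> \sum_a \sum_b cell_mass mu n a b = 1.
Proof.
move=> hmu; apply: (@EFin_inj R); rewrite -(sgraphon_unitsq hmu).
pose one := @step R n (fun=> 1).
transitivity (\int[mu]_(z in unitsq R) (one z.1 * one z.2)%:E)%E.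
  rewrite /one plane_energy_step //; congr (_%:E); apply: eq_bigr => a _.
  by apply: eq_bigr => b _; rewrite mul1r mulr1.
transitivity (\int[mu]_(z in unitsq R) (cst 1%E z))%E.
  apply: eq_integral => z /set_mem[z1 z2].
  have [a za] := @cell_cover _ n _ z1; have [b zb] := @cell_cover _ n _ z2.
  by rewrite /one (stepE _ za) (stepE _ zb) mulr1.
by rewrite integral_cst ?mul1e //; exact: measurable_unitsq.
Qed.

Lemma Cmeas_box (k : nat) :
  Cmeas mu k `<=` [set A : 'M[R]_k | forall i j, 0 <= A i j <= 1].
Proof.
rewrite /Cmeas [X in _ `<=` X](closure_id _).1; last exact: unit_box_closed.
apply: closure_subset => A [f fp Af] i j; have [mf _ _ _] := fp.
have f01 i' x (Ix : unitI R x) := frac_partition_le1 i' fp Ix.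
rewrite -!lee_fin Af; apply/andP; split.
  apply: integral_ge0 => z [z1 z2]; rewrite lee_fin.
  by rewrite mulr_ge0 //; [case/andP: (f01 i _ z1)|case/andP: (f01 j _ z2)].
apply: (@le_trans _ _ (\int[mu]_(z in unitsq R) (cst 1%:E) z)%E).
  apply: ge0_le_integral => //.
  - move=> z [z1 z2]; rewrite lee_fin.
    by rewrite mulr_ge0 //; [case/andP: (f01 i _ z1)|case/andP: (f01 j _ z2)].
  - by apply/measurable_EFinP; exact: measurable_plane_prod.
  - move=> z [z1 z2]; rewrite lee_fin.
    have /andP[? ?] := f01 i _ z1; have /andP[? ?] := f01 j _ z2.
    exact: mulr_ile1.
rewrite integral_cst; last exact: measurable_unitsq.
rewrite mul1e; apply: probability_le1; exact: measurable_unitsq.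
Qed.

Lemma Cmeas_compact (k : nat) : compact (Cmeas mu k).
Proof.
apply: (subclosed_compact _ (@unit_box_compact R k k) (@Cmeas_box k)).
exact: closed_closure.
Qed.

(** A point of C(mu,k) is close to the energies of some fractional partition,
    and these to the energies of step functions at all fine levels; compactness
    turns this into a level that does not depend on the point. *)
Lemma Cmeas_step_approx (k : nat) (e : R) : (0 < k)%N -> 0 < e ->
  \forall n \near \oo, forall A, Cmeas mu k A ->
    exists2 B, Cmx (cell_mass mu n) k B & entrywise_close e A B.
Proof.
move=> k0 e0; pose P n (A : 'M[R]_k) :=
  exists2 B, Cmx (cell_mass mu n) k B & entrywise_close e A B.
have cover := (compact_near_coveringP (Cmeas mu k)).1 (@Cmeas_compact k).
apply: (cover _ \oo (P)) => A CA.
have e4 : 0 < e / 4 by rewrite divr_gt0.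
have [X [[f fp fX] [_ AX]]] := CA _ (nbhsx_ballx A _ e4).
have [m mfin ctl] := control_measure mu.
have e8 : 0 < e / 8 by rewrite divr_gt0.
have [mf _ _ _] := fp.
have lebesgue_le h mh h0 := let: And3 l _ _ := ctl h mh h0 in l.
exists (ball A (e / 4), [set n | exists2 M : 'M[R]_(k, n.+1), Kmx M &
    forall i, (L1dist m (f i) (step (M i)) <= (e / 8)%:E)%E]).
  split; first exact: nbhsx_ballx.
  exact: (partition_step_approx mfin lebesgue_le k0 fp e8).
move=> [A' n] /= [[_ AA'] [M KM fM]].
pose Y := M *m cell_mass mu n *m M^T.
exists Y; first by exists M.
move=> i j; have XM : `|X i j - Y i j| <= 2 * (e / 8).
  rewrite /Y mulmx_energy; apply: (plane_energy_close ctl) => //.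
  - by move=> x Ix; exact: (frac_partition_le1 i fp Ix).
  - by move=> x Ix; exact: (frac_partition_le1 j fp Ix).
  - by move=> a; exact: Kmx_le1.
  - by move=> a; exact: Kmx_le1.
  - by rewrite fX.
have := AX i j; have := AA' i j; rewrite /ball /= => d1 d2.
have -> : A' i j - Y i j = (A' i j - A i j)
   + ((A i j - X i j) + (X i j - Y i j)) by ring.
apply: le_trans (ler_normD _ _) _.
have := ler_normD (A i j - X i j) (X i j - Y i j).
rewrite distrC in d1; lra.
Qed.

End cmeas.

Theorem theorem4p7 (R : realType)
    (mu : probability (measurableTypeR R * measurableTypeR R)%type R)
    (hmu : sgraphon mu) :
  exists G : nat -> sgraph,
    [/\ forall i, has_edge (G i),
        s_convergent R G
      & forall k : nat, (0 < k)%N ->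
          hausdorff_cvg (fun i => C0 R (G i) k) (Cmeas mu k)].
Proof.
have /choice [G Gprop] (n : nat) : exists G : sgraph, has_edge G /\
  forall k, (0 < k)%N ->
    (forall A, C0 R G k A ->
       exists2 B, Cmx (cell_mass mu n) k B & entrywise_close n.+1%:R^-1 A B) /\
    (forall B, Cmx (cell_mass mu n) k B ->
       exists2 A, C0 R G k A & entrywise_close n.+1%:R^-1 A B).
  have [|||| G Gedge GS] := @graph_of_matrix R n.+1 (cell_mass mu n) n.+1%:R^-1.
  - by rewrite invr_gt0 ltr0n.
  - exact: cell_mass_ge0.
  - by move=> a b; exact: cell_mass_sym.
  - exact: sum_cell_mass.
  by exists G.
suff cvg k : (0 < k)%N -> hausdorff_cvg (fun i => C0 R (G i) k) (Cmeas mu k).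
  exists G; split; [by move=> i; case: (Gprop i)| |exact: cvg].
  by move=> k k0; exists (Cmeas mu k); exact: cvg.
move=> k0; apply: hausdorff_cvg_entrywise.
- move=> i; have [M KM] := @Kmx_nonempty R k (gorder (G i)) k0.
  by do 2!eexists; [exists M|].
- by move=> i; exact: C0_compact.
- exact: Cmeas_nonempty.
- exact: Cmeas_compact.
move=> e e0; have e2 : 0 < e / 2 by rewrite divr_gt0.
near=> n.
have ne : n.+1%:R^-1 <= e / 2.
  by near: n; have := near_infty_natSinv_lt (PosNum e2); apply: filterS => n /ltW.
have [C0_Cmx Cmx_C0] := (Gprop n).2 k k0; split.
- move=> A /C0_Cmx[B CB AB]; exists B; first exact: Cmx_cell_mass_sub CB.
  move=> i j; apply: le_trans (AB i j) (le_trans ne _).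
  by rewrite ler_pdivrMr // ler_peMr ?(ltW e0) // ler1n.
- have approx : forall B, Cmeas mu k B ->
      exists2 C, Cmx (cell_mass mu n) k C & entrywise_close (e / 2) B C.
    by near: n; exact: Cmeas_step_approx.
  move=> B /approx[C /Cmx_C0[A CA AC] BC]; exists A => // i j.
  have AC' := le_trans (AC i j) ne; have BC' := BC i j; rewrite distrC in BC'.
  have -> : A i j - B i j = (A i j - C i j) + (C i j - B i j) by ring.
  by apply: le_trans (ler_normD _ _) _; rewrite [e]splitr lerD.
Unshelve. all: by end_near. Qed.
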